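(* Let $\mathcal G_\bullet=(\mathcal G_1\rightrightarrows\mathcal G_0)$ be a coherent Lie 2-group. The following data give a 2-representation of $\mathcal G_\bullet$ (that is, they underlie a pseudofunctor $B\mathcal G_\bullet\to2\mathsf{Vect}$): (i) the unique object $*$ of $B\mathcal G_\bullet$ is sent to $\mathsf{Rep}^{\mathcal G_\bullet}$, the category of representations of the underlying Lie groupoid of $\mathcal G_\bullet$; (ii) each $g\in\mathcal G_0$ is sent to the functor $F_g:\mathsf{Rep}^{\mathcal G_\bullet}\to\mathsf{Rep}^{\mathcal G_\bullet}$ defined, for an object $\rho$ with fibres $V_x=\rho(x)$, by $F_g(\rho):x\mapsto\rho(x\circ_hg)=V_{x\circ_hg}$, $(x\xrightarrow{b}y)\mapsto\big(V_{x\circ_hg}\xrightarrow{\rho(b\cdot_h1_g)}V_{y\circ_hg}\big)$, and, for a morphism $f:\rho\Rightarrow\rho'$, by $F_g(f)_x=f_{x\circ_hg}$; (iii) each arrow $g_1:g_0\to g_0'$ in $\mathcal G_1$ is sent to the natural transformation $F_{g_1}:F_{g_0}\Rightarrow F_{g_0'}$ with $F_{g_1}(\rho)_x:F_{g_0}(\rho)(x)\to F_{g_0'}(\rho)(x)$, $v\mapsto\rho(1_x\cdot_hg_1)(v)$.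
   Context: $k$ is a field of characteristic zero (typically $\mathbb R$ or $\mathbb C$). A coherent Lie 2-group $\mathcal G_\bullet=(\mathcal G_1\rightrightarrows\mathcal G_0)$ is a group object in the bicategory of Lie groupoids: a Lie groupoid with a multiplication $m:\mathcal G_\bullet\times\mathcal G_\bullet\to\mathcal G_\bullet$ and unit $u:*\to\mathcal G_\bullet$ such that $(\mathrm{pr}_1,m)$ is an equivalence, together with invertible 2-morphisms $a:m\circ(m\times1)\Rightarrow m\circ(1\times m)$, $l:m\circ(u\times1)\Rightarrow1$, $r:m\circ(1\times u)\Rightarrow1$ satisfying the pentagon and triangle identities. Write $x\circ_hg=m(x,g)$ on objects, $b\cdot_hc=m(b,c)$ on arrows, and $1_g$ for the identity arrow of $g$. $B\mathcal G_\bullet$ is the one-object bicategory with hom-category $\mathcal G_\bullet$ and horizontal composition $m$. $2\mathsf{Vect}$ is the strict 2-category of $k$-prelinear categories (hom-sets are $k$-vector spaces, composition $k$-bilinear), $k$-linear functors and natural transformations. A 2-representation of $\mathcal G_\bullet$ is a pseudofunctor $B\mathcal G_\bullet\to2\mathsf{Vect}$. For a Lie groupoid $\Gamma_\bullet$, $\mathsf{Rep}^{\Gamma_\bullet}$ is the category whose objects are vector bundles $V\to\Gamma_0$ equipped with a Lie groupoid morphism $\rho$ from $\Gamma_\bullet$ to the groupoid of linear isomorphisms between fibres of $V$ (so $\rho(x)=V_x$ and an arrow $b:x\to y$ gives $\rho(b):V_x\to V_y$), and whose morphisms are $\Gamma_\bullet$-equivariant bundle maps. *)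

(* Defs.v *)
From HB Require Import structures.
From mathcomp Require Import all_boot all_order all_algebra all_field.
From mathcomp Require Import all_classical all_reals all_analysis.
Set Implicit Arguments. Unset Strict Implicit. Unset Printing Implicit Defensive.
Import Order.TTheory GRing.Theory Num.Theory.
Import numFieldNormedType.Exports.
Local Open Scope classical_set_scope.
Local Open Scope ring_scope.

(* Horizontal composition follows the order of functional composition:
   [hcomp f g] is "f after g". *)
Record bicategory := Bicategory {
  cell0 : Type;
  cell1 : cell0 -> cell0 -> Type;
  cell2 : forall a b, cell1 a b -> cell1 a b -> Type;
  id2 : forall a b (f : cell1 a b), cell2 f f;
  vcomp : forall a b (f g h : cell1 a b), cell2 g h -> cell2 f g -> cell2 f h;
  id1 : forall a, cell1 a a;
  hcomp : forall a b c, cell1 b c -> cell1 a b -> cell1 a c;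
  hcomp2 : forall a b c (f f' : cell1 b c) (g g' : cell1 a b),
    cell2 f f' -> cell2 g g' -> cell2 (hcomp f g) (hcomp f' g');
  associator : forall a b c d (f : cell1 c d) (g : cell1 b c) (h : cell1 a b),
    cell2 (hcomp (hcomp f g) h) (hcomp f (hcomp g h));
  associator_inv : forall a b c d (f : cell1 c d) (g : cell1 b c) (h : cell1 a b),
    cell2 (hcomp f (hcomp g h)) (hcomp (hcomp f g) h);
  lunitor : forall a b (f : cell1 a b), cell2 (hcomp (id1 b) f) f;
  lunitor_inv : forall a b (f : cell1 a b), cell2 f (hcomp (id1 b) f);
  runitor : forall a b (f : cell1 a b), cell2 (hcomp f (id1 a)) f;
  runitor_inv : forall a b (f : cell1 a b), cell2 f (hcomp f (id1 a));
  vcompA : forall a b (f g h k : cell1 a b)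
    (w : cell2 h k) (v : cell2 g h) (u : cell2 f g),
    vcomp w (vcomp v u) = vcomp (vcomp w v) u;
  vcomp1l : forall a b (f g : cell1 a b) (u : cell2 f g), vcomp (id2 g) u = u;
  vcomp1r : forall a b (f g : cell1 a b) (u : cell2 f g), vcomp u (id2 f) = u;
  hcomp2_id : forall a b c (f : cell1 b c) (g : cell1 a b),
    hcomp2 (id2 f) (id2 g) = id2 (hcomp f g);
  hcomp2_vcomp : forall a b c (f f' f'' : cell1 b c) (g g' g'' : cell1 a b)
    (u' : cell2 f' f'') (u : cell2 f f') (v' : cell2 g' g'') (v : cell2 g g'),
    hcomp2 (vcomp u' u) (vcomp v' v) = vcomp (hcomp2 u' v') (hcomp2 u v);
  associatorK : forall a b c d (f : cell1 c d) (g : cell1 b c) (h : cell1 a b),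
    vcomp (associator_inv f g h) (associator f g h) = id2 _;
  associatorVK : forall a b c d (f : cell1 c d) (g : cell1 b c) (h : cell1 a b),
    vcomp (associator f g h) (associator_inv f g h) = id2 _;
  lunitorK : forall a b (f : cell1 a b), vcomp (lunitor_inv f) (lunitor f) = id2 _;
  lunitorVK : forall a b (f : cell1 a b), vcomp (lunitor f) (lunitor_inv f) = id2 _;
  runitorK : forall a b (f : cell1 a b), vcomp (runitor_inv f) (runitor f) = id2 _;
  runitorVK : forall a b (f : cell1 a b), vcomp (runitor f) (runitor_inv f) = id2 _;
  associator_nat : forall a b c d (f f' : cell1 c d) (g g' : cell1 b c)
    (h h' : cell1 a b) (u : cell2 f f') (v : cell2 g g') (w : cell2 h h'),
    vcomp (associator f' g' h') (hcomp2 (hcomp2 u v) w) =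
    vcomp (hcomp2 u (hcomp2 v w)) (associator f g h);
  lunitor_nat : forall a b (f f' : cell1 a b) (u : cell2 f f'),
    vcomp (lunitor f') (hcomp2 (id2 (id1 b)) u) = vcomp u (lunitor f);
  runitor_nat : forall a b (f f' : cell1 a b) (u : cell2 f f'),
    vcomp (runitor f') (hcomp2 u (id2 (id1 a))) = vcomp u (runitor f);
  bicat_pentagon : forall a b c d e (f : cell1 d e) (g : cell1 c d)
    (h : cell1 b c) (k : cell1 a b),
    vcomp (hcomp2 (id2 f) (associator g h k))
      (vcomp (associator f (hcomp g h) k) (hcomp2 (associator f g h) (id2 k))) =
    vcomp (associator f g (hcomp h k)) (associator (hcomp f g) h k);
  bicat_triangle : forall a b c (f : cell1 b c) (g : cell1 a b),
    vcomp (hcomp2 (id2 f) (lunitor g)) (associator f (id1 b) g) =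
    hcomp2 (runitor f) (id2 g) }.

(* A pseudofunctor is split into its values on 0-, 1- and 2-cells
   ([pseudofunctor_data]) and the remaining structure and axioms
   ([pseudofunctor_on]), so that one can say that given values underlie a
   pseudofunctor. *)
Record pseudofunctor_data (B C : bicategory) := PseudofunctorData {
  pf0 : cell0 B -> cell0 C;
  pf1 : forall a b, cell1 a b -> cell1 (pf0 a) (pf0 b);
  pf2 : forall a b (f g : cell1 a b), cell2 f g -> cell2 (pf1 f) (pf1 g) }.

Record pseudofunctor_on (B C : bicategory) (P : pseudofunctor_data B C) :=
    PseudofunctorOn {
  pf_mul : forall a b c (f : @cell1 B b c) (g : @cell1 B a b),
    cell2 (hcomp (pf1 P f) (pf1 P g)) (pf1 P (hcomp f g));
  pf_mul_inv : forall a b c (f : @cell1 B b c) (g : @cell1 B a b),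
    cell2 (pf1 P (hcomp f g)) (hcomp (pf1 P f) (pf1 P g));
  pf_unit : forall a, cell2 (id1 (pf0 P a)) (pf1 P (id1 a));
  pf_unit_inv : forall a, cell2 (pf1 P (id1 a)) (id1 (pf0 P a));
  pf2_id : forall a b (f : @cell1 B a b), pf2 P (id2 f) = id2 (pf1 P f);
  pf2_vcomp : forall a b (f g h : @cell1 B a b) (v : cell2 g h) (u : cell2 f g),
    pf2 P (vcomp v u) = vcomp (pf2 P v) (pf2 P u);
  pf_mulK : forall a b c (f : @cell1 B b c) (g : @cell1 B a b),
    vcomp (pf_mul_inv f g) (pf_mul f g) = id2 _;
  pf_mulVK : forall a b c (f : @cell1 B b c) (g : @cell1 B a b),
    vcomp (pf_mul f g) (pf_mul_inv f g) = id2 _;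
  pf_unitK : forall a, vcomp (pf_unit_inv a) (pf_unit a) = id2 _;
  pf_unitVK : forall a, vcomp (pf_unit a) (pf_unit_inv a) = id2 _;
  pf_mul_nat : forall a b c (f f' : @cell1 B b c) (g g' : @cell1 B a b)
    (u : cell2 f f') (v : cell2 g g'),
    vcomp (pf_mul f' g') (hcomp2 (pf2 P u) (pf2 P v)) =
    vcomp (pf2 P (hcomp2 u v)) (pf_mul f g);
  pf_assoc : forall a b c d (f : @cell1 B c d) (g : @cell1 B b c) (h : @cell1 B a b),
    vcomp (pf2 P (associator f g h))
      (vcomp (pf_mul (hcomp f g) h) (hcomp2 (pf_mul f g) (id2 (pf1 P h)))) =
    vcomp (pf_mul f (hcomp g h))
      (vcomp (hcomp2 (id2 (pf1 P f)) (pf_mul g h))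
        (associator (pf1 P f) (pf1 P g) (pf1 P h)));
  pf_lunit : forall a b (f : @cell1 B a b),
    vcomp (pf2 P (lunitor f))
      (vcomp (pf_mul (id1 b) f) (hcomp2 (pf_unit b) (id2 (pf1 P f)))) =
    lunitor (pf1 P f);
  pf_runit : forall a b (f : @cell1 B a b),
    vcomp (pf2 P (runitor f))
      (vcomp (pf_mul f (id1 a)) (hcomp2 (id2 (pf1 P f)) (pf_unit a))) =
    runitor (pf1 P f) }.

Section TwoVect.
Variable K : fieldType.

(* [lcomp_linl] and [lcomp_linr] together say that composition is bilinear. *)
Record lincat := LinCat {
  lob : Type;
  lhom : lob -> lob -> lmodType K;
  lid : forall x, lhom x x;
  lcomp : forall x y z, lhom y z -> lhom x y -> lhom x z;
  lcompA : forall x y z w (h : lhom z w) (g : lhom y z) (f : lhom x y),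
    lcomp h (lcomp g f) = lcomp (lcomp h g) f;
  lcomp1l : forall x y (f : lhom x y), lcomp (lid y) f = f;
  lcomp1r : forall x y (f : lhom x y), lcomp f (lid x) = f;
  lcomp_linl : forall x y z (f : lhom x y), linear (fun g : lhom y z => lcomp g f);
  lcomp_linr : forall x y z (g : lhom y z), linear (fun f : lhom x y => lcomp g f) }.

Record linfunctor (C D : lincat) := LinFunctor {
  fob :> lob C -> lob D;
  fhom : forall x y, lhom x y -> lhom (fob x) (fob y);
  fhom_lin : forall x y, linear (@fhom x y);
  fhom_id : forall x, fhom (lid x) = lid (fob x);
  fhom_comp : forall x y z (g : lhom y z) (f : lhom x y),
    fhom (lcomp g f) = lcomp (fhom g) (fhom f) }.

Record nattrans (C D : lincat) (F G : linfunctor C D) := NatTrans {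
  ncomp :> forall x, lhom (F x) (G x);
  ncomp_nat : forall x y (f : lhom x y),
    lcomp (ncomp y) (fhom F f) = lcomp (fhom G f) (ncomp x) }.

Lemma nattransP C D (F G : linfunctor C D) (u v : nattrans F G) :
  (forall x, u x = v x) -> u = v.
Proof.
case: u v => u un [v vn] /= uv.
have E : u = v by apply: functional_extensionality_dep.
by subst v; congr NatTrans; apply: Prop_irrelevance.
Qed.

Definition linfunctor_id (C : lincat) : linfunctor C C.
Proof. by exists id (fun _ _ f => f). Defined.

Definition linfunctor_comp (C D E : lincat) (F : linfunctor D E)
  (G : linfunctor C D) : linfunctor C E.
Proof.
exists (fun x => F (G x)) (fun _ _ f => fhom F (fhom G f)).
- by move=> x y a f g; rewrite (fhom_lin G) (fhom_lin F).
- by move=> x; rewrite (fhom_id G) (fhom_id F).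
- by move=> x y z g f; rewrite (fhom_comp G) (fhom_comp F).
Defined.

Definition nattrans_id (C D : lincat) (F : linfunctor C D) : nattrans F F.
Proof.
by refine (@NatTrans _ _ _ _ (fun x => lid (F x)) _) => x y f; rewrite lcomp1l lcomp1r.
Defined.

Definition nattrans_vcomp (C D : lincat) (F G H : linfunctor C D)
  (v : nattrans G H) (u : nattrans F G) : nattrans F H.
Proof.
exists (fun x => lcomp (v x) (u x)) => x y f.
by rewrite -lcompA ncomp_nat lcompA ncomp_nat -lcompA.
Defined.

Definition nattrans_hcomp (C D E : lincat) (F F' : linfunctor D E)
  (G G' : linfunctor C D) (u : nattrans F F') (v : nattrans G G') :
  nattrans (linfunctor_comp F G) (linfunctor_comp F' G').
Proof.
exists (fun x => lcomp (u (G' x)) (fhom F (v x))) => x y f /=.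
by rewrite -lcompA -fhom_comp (ncomp_nat v) fhom_comp lcompA (ncomp_nat u) -lcompA.
Defined.

Definition nattrans_assoc (C D E E' : lincat) (F : linfunctor E E')
  (G : linfunctor D E) (H : linfunctor C D) :
  nattrans (linfunctor_comp (linfunctor_comp F G) H)
           (linfunctor_comp F (linfunctor_comp G H)).
Proof.
by refine (@NatTrans _ _ (linfunctor_comp (linfunctor_comp F G) H)
  (linfunctor_comp F (linfunctor_comp G H))
  (fun x => lid (F (G (H x)))) _) => x y f; rewrite lcomp1l lcomp1r.
Defined.

Definition nattrans_assoc_inv (C D E E' : lincat) (F : linfunctor E E')
  (G : linfunctor D E) (H : linfunctor C D) :
  nattrans (linfunctor_comp F (linfunctor_comp G H))
           (linfunctor_comp (linfunctor_comp F G) H).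
Proof.
by refine (@NatTrans _ _ (linfunctor_comp F (linfunctor_comp G H))
  (linfunctor_comp (linfunctor_comp F G) H)
  (fun x => lid (F (G (H x)))) _) => x y f; rewrite lcomp1l lcomp1r.
Defined.

Definition nattrans_lunit (C D : lincat) (F : linfunctor C D) :
  nattrans (linfunctor_comp (linfunctor_id D) F) F.
Proof.
by refine (@NatTrans _ _ (linfunctor_comp (linfunctor_id D) F) F
  (fun x => lid (F x)) _) => x y f; rewrite lcomp1l lcomp1r.
Defined.

Definition nattrans_lunit_inv (C D : lincat) (F : linfunctor C D) :
  nattrans F (linfunctor_comp (linfunctor_id D) F).
Proof.
by refine (@NatTrans _ _ F (linfunctor_comp (linfunctor_id D) F)
  (fun x => lid (F x)) _) => x y f; rewrite lcomp1l lcomp1r.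
Defined.

Definition nattrans_runit (C D : lincat) (F : linfunctor C D) :
  nattrans (linfunctor_comp F (linfunctor_id C)) F.
Proof.
by refine (@NatTrans _ _ (linfunctor_comp F (linfunctor_id C)) F
  (fun x => lid (F x)) _) => x y f; rewrite lcomp1l lcomp1r.
Defined.

Definition nattrans_runit_inv (C D : lincat) (F : linfunctor C D) :
  nattrans F (linfunctor_comp F (linfunctor_id C)).
Proof.
by refine (@NatTrans _ _ F (linfunctor_comp F (linfunctor_id C))
  (fun x => lid (F x)) _) => x y f; rewrite lcomp1l lcomp1r.
Defined.

(* 2Vect is a strict 2-category: composition of functors is strictly associative
   and unital, and the associators and unitors have identity components. *)
Definition two_vect : bicategory.
Proof.
refine (@Bicategory lincat linfunctor nattrans nattrans_id nattrans_vcomp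
  linfunctor_id linfunctor_comp nattrans_hcomp nattrans_assoc nattrans_assoc_inv
  nattrans_lunit nattrans_lunit_inv nattrans_runit nattrans_runit_inv
  _ _ _ _ _ _ _ _ _ _ _ _ _ _ _ _).
- by move=> *; apply: nattransP => x /=; rewrite lcompA.
- by move=> *; apply: nattransP => x /=; rewrite lcomp1l.
- by move=> *; apply: nattransP => x /=; rewrite lcomp1r.
- by move=> *; apply: nattransP => x /=; rewrite fhom_id lcomp1l.
- move=> *; apply: nattransP => x /=.
  rewrite fhom_comp -!lcompA; congr lcomp.
  by rewrite !lcompA ncomp_nat.
all: try by move=> *; apply: nattransP => x /=; rewrite lcomp1l.
- move=> *; apply: nattransP => x /=.
  by rewrite lcomp1l lcomp1r fhom_comp lcompA.
- by move=> *; apply: nattransP => x /=; rewrite !lcomp1l lcomp1r.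
- by move=> *; apply: nattransP => x /=; rewrite fhom_id lcomp1l !lcomp1r.
- by move=> *; apply: nattransP => x /=; rewrite !fhom_id !lcomp1l.
- by move=> *; apply: nattransP => x /=; rewrite !fhom_id !lcomp1l.
Defined.

End TwoVect.

Section Cinf.
Context {R : realType}.

(* Maps between open subsets of Euclidean spaces are total functions whose values
   outside the open set are irrelevant.  [times_differentiable k U f] says that f
   is k times Frechet differentiable on U: f is differentiable on U and each
   x |-> 'd f x v is k-1 times differentiable on U. *)
Fixpoint times_differentiable (n k : nat) (U : set 'rV[R]_n)
    (f : 'rV[R]_n -> R) : Prop :=
  if k is k'.+1 then
    (forall x, U x -> differentiable f x) /\
    (forall v, times_differentiable k' U (fun x => 'd f x v))
  else True.

Definition cinf n (U : set 'rV[R]_n) (f : 'rV[R]_n -> R) : Prop :=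
  forall k, times_differentiable k U f.

Definition cinf_map n m (U : set 'rV[R]_n) (f : 'rV[R]_n -> 'rV[R]_m) : Prop :=
  forall i, cinf U (fun x => f x 0 i).


Lemma near0_is_diff (V W : normedModType R) (h : V -> W) (x : V) :
  (\forall y \near x, h y = 0) -> differentiable h x /\ forall v, 'd h x v = 0.
Proof.
move=> h0; have hx : h x = 0 by exact: (nbhs_singleton h0).
have H : h \o shift x = cst (h x) + (\0 : {linear V -> W}) +o_ 0 id.
  apply/eqaddoP => _/posnumP[e]; near=> y.
  have -> : (h \o shift x - (cst (h x) + (\0 : {linear V -> W}))) y = 0.
    rewrite /= /cst !fctE hx /= addr0 subr0.
    by near: y; have := h0; rewrite (near_shift 0) subr0.
  by rewrite normr0 mulr_ge0.
have c0 : continuous (\0 : {linear V -> W}) by move=> y; exact: cvg_cst.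
have d0 : 'd h x = (\0 : {linear V -> W}) :> (V -> W) by exact: diff_unique c0 H.
split; last by move=> v; rewrite d0.
by apply/diff_locallyP; rewrite d0.
Unshelve. all: by end_near. Qed.

Lemma near_eq_diff (V W : normedModType R) (f g : V -> W) (x : V) :
  (\forall y \near x, f y = g y) -> differentiable f x ->
  differentiable g x /\ forall v, 'd g x v = 'd f x v.
Proof.
move=> fg df; pose h := g - f.
have [dh h0] : differentiable h x /\ forall v, 'd h x v = 0.
  apply: near0_is_diff; apply: filterS fg => y fy.
  by rewrite /h -[LHS]/(g y - f y) fy subrr.
have -> : g = f + h by rewrite /h addrC subrK.
split; first exact: differentiableD.
move=> v; have -> := congr1 (@^~ v) (diffD df dh).
by have := congr1 (+%R ('d f x v)) (h0 v); rewrite addr0.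
Qed.

Section Toolkit.
Variable n : nat.
Implicit Types (U W : set 'rV[R]_n) (f g : 'rV[R]_n -> R).
Local Notation td := (@times_differentiable n).

Lemma td_sub k U W f : U `<=` W -> td k W f -> td k U f.
Proof.
move=> UW; elim: k f => [|k IH] f; first by [].
case=> df ddf; split=> [x /UW|v]; first exact: df.
exact/IH/ddf.
Qed.

Lemma td_S k U f : td k.+1 U f -> td k U f.
Proof.
elim: k f => // k IH f [df ddf]; split=> // v.
exact: IH (ddf v).
Qed.

Lemma td_local k U f :
  (forall x, U x -> exists2 W, W x & td k (U `&` W) f) -> td k U f.
Proof.
elim: k f => [|k IH] f H; first by [].
split=> [x Ux|v].
  by have [W Wx [df _]] := H _ Ux; exact: df.
apply: IH => x /H[W Wx [_ ddf]]; exists W => //; exact: ddf.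
Qed.

Lemma td_ext k U f g : open U -> (forall x, U x -> f x = g x) ->
  td k U f -> td k U g.
Proof.
move=> oU; elim: k f g => [|k IH] f g fg; first by [].
case=> df ddf.
have E x : U x -> differentiable g x /\ forall v, 'd g x v = 'd f x v.
  move=> Ux; apply: near_eq_diff; last exact: df.
  by apply: (filterS fg); exact: open_nbhs_nbhs.
split=> [x /E[dg _]|v]; first exact: dg.
apply: IH (ddf v) => x /E[_ e]; exact: esym (e v).
Qed.

Lemma td_cst k U (a : R) : td k U (cst a).
Proof.
elim: k a => [|k IH] a; first by [].
split=> [x _|v]; first exact: differentiable_cst.
have -> : (fun x => 'd (cst a : 'rV[R]_n -> R) x v) = cst 0.
  by apply/funext => x; rewrite diff_cst.
exact: IH.
Qed.

Lemma td_coord k U i : td k U (fun x => x 0 i).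
Proof.
case: k => //= k; split=> [x _|v]; first exact: differentiable_coord.
have -> : (fun x : 'rV[R]_n => 'd (fun y : 'rV[R]_n => y 0 i : R) x v) = cst (v 0 i).
  apply/funext => x.
  have @f : {linear 'rV[R]_n -> R}.
    by exists (fun N : 'rV[R]_n => N 0 i); do 2![eexists]; do ?[constructor];
       rewrite ?mxE// => ? *; rewrite ?mxE//; move=> ?; rewrite !mxE.
  rewrite (_ : (fun _ => _) = f) // diff_lin//.
  exact: coord_continuous.
exact: td_cst.
Qed.

Lemma tdD k U f g : open U -> td k U f -> td k U g -> td k U (fun x => f x + g x).
Proof.
move=> oU; elim: k f g => [|k IH] f g; first by [].
case=> df ddf; case=> dg ddg.
have -> : (fun x => f x + g x) = f + g by [].
split=> [x Ux|v]; first exact: differentiableD (df _ Ux) (dg _ Ux).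
apply: (td_ext oU) (IH _ _ (ddf v) (ddg v)) => x Ux.
exact: esym (congr1 (@^~ v) (diffD (df _ Ux) (dg _ Ux))).
Qed.

Lemma tdM k U f g : open U -> td k U f -> td k U g -> td k U (fun x => f x * g x).
Proof.
move=> oU; elim: k f g => [|k IH] f g; first by [].
case=> df ddf; case=> dg ddg.
have -> : (fun x => f x * g x) = f * g by [].
split=> [x Ux|v]; first exact: differentiableM (df _ Ux) (dg _ Ux).
have Kf := @td_S k U f (conj df ddf).
have Kg := @td_S k U g (conj dg ddg).
apply: (td_ext oU) (tdD oU (IH _ _ Kf (ddg v)) (IH _ _ Kg (ddf v))) => x Ux.
exact: esym (congr1 (@^~ v) (diffM (df _ Ux) (dg _ Ux))).
Qed.

Lemma td_sum k U (I : Type) (r : seq I) (F : I -> 'rV[R]_n -> R) : open U ->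
  (forall i, td k U (F i)) -> td k U (fun x => \sum_(i <- r) F i x).
Proof.
move=> oU HF; elim: r => [|i r IH].
  have -> : (fun x => \sum_(i <- [::]) F i x) = cst 0.
    by apply/funext=> x; rewrite big_nil.
  exact: td_cst.
have -> : (fun x => \sum_(i <- i :: r) F i x) = (fun x => F i x + \sum_(i <- r) F i x).
  by apply/funext=> x; rewrite big_cons.
exact: tdD.
Qed.
End Toolkit.

Lemma rV_differentiable n m (f : 'rV[R]_n -> 'rV[R]_m) x :
  (forall i, differentiable (fun x => f x 0 i) x) -> differentiable f x.
Proof.
move=> df; have -> : f = \sum_(i < m) (fun x => f x 0 i *: delta_mx 0 i).
  by apply/funext => y; rewrite fct_sumE [LHS]row_sum_delta.
by apply: differentiable_sum => i; exact: differentiableZl.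
Qed.

Lemma diff_rV n m (f : 'rV[R]_n -> 'rV[R]_m) x v i :
  differentiable f x -> 'd f x v 0 i = 'd (fun x => f x 0 i) x v.
Proof.
move=> df; rewrite (_ : (fun x => f x 0 i) = (fun y : 'rV[R]_m => y 0 i) \o f)//.
rewrite (diff_comp df (differentiable_coord (f x) 0 i)) /=.
have @g : {linear 'rV[R]_m -> R}.
  by exists (fun N : 'rV[R]_m => N 0 i); do 2![eexists]; do ?[constructor];
     rewrite ?mxE// => ? *; rewrite ?mxE//; move=> ?; rewrite !mxE.
rewrite (_ : (fun y : 'rV[R]_m => y 0 i : R) = g) // diff_lin//.
exact: coord_continuous.
Qed.

Lemma td_comp n m k (U : set 'rV[R]_n) (W : set 'rV[R]_m) f g : open U ->
  (forall x, U x -> W (f x)) -> (forall i, times_differentiable k U (fun x => f x 0 i)) ->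
  times_differentiable k W g -> times_differentiable k U (fun x => g (f x)).
Proof.
move=> oU UW; elim: k g => [|k IH] g; first by [].
move=> df; case=> dg ddg.
have dfx x : U x -> differentiable f x.
  by move=> Ux; apply: rV_differentiable => i; have [+ _] := df i; exact.
split=> [x Ux|v]; first by apply: differentiable_comp; [exact: dfx|exact/dg/UW].
have H : times_differentiable k U (fun x => \sum_(i < m)
    'd (fun x => f x 0 i) x v * 'd g (f x) (delta_mx 0 i)).
  apply: td_sum => // i; apply: tdM => //; first by have [_] := df i; exact.
  by apply: (IH _ _ (ddg (delta_mx 0 i))) => j; exact/td_S.
apply: (td_ext oU) H => x Ux.
rewrite (_ : (fun x0 => g (f x0)) = g \o f)// (diff_comp (dfx _ Ux) (dg _ (UW _ Ux))) /=.
rewrite [in RHS](row_sum_delta ('d f x v)) linear_sum/=; apply: eq_bigr => i _.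
by rewrite linearZ /= (diff_rV _ _ (dfx _ Ux)).
Qed.
End Cinf.

(* Real smooth manifolds.  A chart is a homeomorphism between an open set [cdom]
   and an open set [ccod] of R^n; [cfwd] and [cbwd] are total functions that only
   matter on these sets.  A [premanifold] is the bare data (space, dimension and
   atlas); [is_manifold] is the defining property, kept apart so that products can
   be written down as data. *)
Record chart (R : realType) (M : topologicalType) (n : nat) := Chart {
  cdom : set M;
  ccod : set 'rV[R]_n;
  cfwd : M -> 'rV[R]_n;
  cbwd : 'rV[R]_n -> M }.

Record is_chart (R : realType) (M : topologicalType) n (c : chart R M n) : Prop := {
  cdom_open : open (cdom c);
  ccod_open : open (ccod c);
  cfwd_cod : forall p, cdom c p -> ccod c (cfwd c p);
  cbwd_dom : forall z, ccod c z -> cdom c (cbwd c z);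
  cfwdK : forall p, cdom c p -> cbwd c (cfwd c p) = p;
  cbwdK : forall z, ccod c z -> cfwd c (cbwd c z) = z;
  cfwd_cont : forall p, cdom c p -> {for p, continuous (cfwd c)};
  cbwd_cont : forall z, ccod c z -> {for z, continuous (cbwd c)} }.

Record premanifold (R : realType) := Premanifold {
  mcarrier :> topologicalType;
  mdim : nat;
  atlas : set (chart R mcarrier mdim) }.
Arguments atlas {R} _.

Section Manifolds.
Context {R : realType}.
Implicit Types M N P : premanifold R.

(* For open W. *)
Definition smooth_on M N (W : set M) (f : M -> N) : Prop :=
  (forall p, W p -> {for p, continuous f}) /\
  forall c d, atlas M c -> atlas N d ->
    cinf_map [set z | ccod c z /\ W (cbwd c z) /\ cdom d (f (cbwd c z))]
             (fun z => cfwd d (f (cbwd c z))).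

Definition smooth M N (f : M -> N) : Prop := smooth_on setT f.

(* Smoothness on an arbitrary subset: local extendability to a smooth map on an
   open set.  On an embedded submanifold, such as the set of composable pairs of a
   Lie groupoid, this is smoothness for the submanifold structure. *)
Definition smooth_on_subset M N (S : set M) (f : M -> N) : Prop :=
  forall p, S p -> exists (W : set M) (g : M -> N),
    [/\ open W, W p, smooth_on W g & forall q, S q -> W q -> g q = f q].

Record is_manifold M : Prop := {
  manifold_hausdorff : hausdorff_space M;
  manifold_second_countable : @second_countable M;
  manifold_chart : forall c, atlas M c -> is_chart c;
  manifold_cover : forall p : M, exists2 c, atlas M c & cdom c p;
  manifold_compat : forall c d, atlas M c -> atlas M d ->
    cinf_map [set z | ccod c z /\ cdom d (cbwd c z)]
             (fun z => cfwd d (cbwd c z)) }.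

(* The differential, read in charts, is onto at every point. *)
Definition submersion M N (f : M -> N) : Prop :=
  forall p c d, atlas M c -> atlas N d -> cdom c p -> cdom d (f p) ->
    forall w, exists v, 'd (fun z => cfwd d (f (cbwd c z))) (cfwd c p) v = w.

Definition euclidean n : premanifold R :=
  @Premanifold R 'rV[R]_n n [set Chart setT setT id id].

Definition prod_chart (M N : topologicalType) m n
    (c : chart R M m) (d : chart R N n) : chart R (M * N)%type (m + n) :=
  Chart [set p | cdom c p.1 /\ cdom d p.2]
        [set z | ccod c (lsubmx z) /\ ccod d (rsubmx z)]
        (fun p => row_mx (cfwd c p.1) (cfwd d p.2))
        (fun z => (cbwd c (lsubmx z), cbwd d (rsubmx z))).

Definition prod_manifold M N : premanifold R :=
  @Premanifold R (M * N)%type (mdim M + mdim N)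
    [set e | exists c d, [/\ atlas M c, atlas N d & e = prod_chart c d]].

End Manifolds.

(* [gcomp b c] is "b after c"; it is total, but only its values on composable
   pairs are constrained. *)
Record groupoid_data (R : realType) := GroupoidData {
  gob : premanifold R;
  garr : premanifold R;
  gsrc : garr -> gob;
  gtgt : garr -> gob;
  gid : gob -> garr;
  ginv : garr -> garr;
  gcomp : garr -> garr -> garr }.

Section LieGroupoids.
Context {R : realType}.
Implicit Types G H L : groupoid_data R.

Definition composable G (b c : garr G) : Prop := gsrc b = gtgt c.

Record is_lie_groupoid G : Prop := {
  lg_ob_manifold : is_manifold (gob G);
  lg_arr_manifold : is_manifold (garr G);
  lg_src_smooth : smooth (@gsrc R G);
  lg_tgt_smooth : smooth (@gtgt R G);
  lg_src_submersion : submersion (@gsrc R G);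
  lg_tgt_submersion : submersion (@gtgt R G);
  lg_id_smooth : smooth (@gid R G);
  lg_inv_smooth : smooth (@ginv R G);
  lg_comp_smooth :
    smooth_on_subset (M := prod_manifold (garr G) (garr G))
      [set p | composable p.1 p.2] (fun p => gcomp p.1 p.2);
  lg_src_id : forall x : gob G, gsrc (gid x) = x;
  lg_tgt_id : forall x : gob G, gtgt (gid x) = x;
  lg_src_inv : forall b : garr G, gsrc (ginv b) = gtgt b;
  lg_tgt_inv : forall b : garr G, gtgt (ginv b) = gsrc b;
  lg_src_comp : forall b c : garr G, composable b c -> gsrc (gcomp b c) = gsrc c;
  lg_tgt_comp : forall b c : garr G, composable b c -> gtgt (gcomp b c) = gtgt b;
  lg_compA : forall b c d : garr G, composable b c -> composable c d ->
    gcomp b (gcomp c d) = gcomp (gcomp b c) d;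
  lg_comp1l : forall b : garr G, gcomp (gid (gtgt b)) b = b;
  lg_comp1r : forall b : garr G, gcomp b (gid (gsrc b)) = b;
  lg_compVl : forall b : garr G, gcomp (ginv b) b = gid (gsrc b);
  lg_compVr : forall b : garr G, gcomp b (ginv b) = gid (gtgt b) }.

Record gfunctor G H := GFunctor {
  gf0 : gob G -> gob H;
  gf1 : garr G -> garr H }.

Record is_lie_functor G H (F : gfunctor G H) : Prop := {
  lf_ob_smooth : smooth (gf0 F);
  lf_arr_smooth : smooth (gf1 F);
  lf_src : forall b, gsrc (gf1 F b) = gf0 F (gsrc b);
  lf_tgt : forall b, gtgt (gf1 F b) = gf0 F (gtgt b);
  lf_id : forall x, gf1 F (gid x) = gid (gf0 F x);
  lf_comp : forall b c, composable b c ->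
    gf1 F (gcomp b c) = gcomp (gf1 F b) (gf1 F c) }.

(* Smooth natural transformations, i.e. the 2-morphisms of Lie groupoids; they are
   all invertible, by [ginv]. *)
Record is_smooth_nat G H (E F : gfunctor G H) (u : gob G -> garr H) : Prop := {
  sn_smooth : smooth u;
  sn_src : forall x, gsrc (u x) = gf0 E x;
  sn_tgt : forall x, gtgt (u x) = gf0 F x;
  sn_nat : forall b,
    gcomp (u (gtgt b)) (gf1 E b) = gcomp (gf1 F b) (u (gsrc b)) }.

Definition gfunctor_id G : gfunctor G G := GFunctor id id.

Definition gfunctor_comp G H L (F : gfunctor H L) (E : gfunctor G H) : gfunctor G L :=
  GFunctor (gf0 F \o gf0 E) (gf1 F \o gf1 E).

(* Equivalence in the bicategory of Lie groupoids, smooth functors and smooth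
   natural transformations. *)
Definition is_lie_equivalence G H (F : gfunctor G H) : Prop :=
  exists (E : gfunctor H G) u v,
    [/\ is_lie_functor E,
        is_smooth_nat (gfunctor_comp F E) (gfunctor_id H) u &
        is_smooth_nat (gfunctor_comp E F) (gfunctor_id G) v].

Definition prod_groupoid G H : groupoid_data R :=
  @GroupoidData R (prod_manifold (gob G) (gob H)) (prod_manifold (garr G) (garr H))
    (fun b => (gsrc b.1, gsrc b.2)) (fun b => (gtgt b.1, gtgt b.2))
    (fun x => (gid x.1, gid x.2)) (fun b => (ginv b.1, ginv b.2))
    (fun b c => (gcomp b.1 c.1, gcomp b.2 c.2)).

Definition gfst G H : gfunctor (prod_groupoid G H) G :=
  @GFunctor (prod_groupoid G H) G fst fst.
Definition gsnd G H : gfunctor (prod_groupoid G H) H :=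
  @GFunctor (prod_groupoid G H) H snd snd.
Definition gpair G H L (E : gfunctor G H) (F : gfunctor G L) :
    gfunctor G (prod_groupoid H L) :=
  @GFunctor G (prod_groupoid H L) (fun x => (gf0 E x, gf0 F x))
    (fun b => (gf1 E b, gf1 F b)).

(* The terminal Lie groupoid, on the one-point manifold R^0. *)
Definition point_groupoid : groupoid_data R :=
  @GroupoidData R (euclidean 0) (euclidean 0) id id id id (fun b _ => b).

Definition gterminal G : gfunctor G point_groupoid :=
  @GFunctor G point_groupoid (fun=> 0) (fun=> 0).

End LieGroupoids.

Record lie_groupoid (R : realType) := LieGroupoid {
  lg_data :> groupoid_data R;
  lgP : is_lie_groupoid lg_data }.

Section Coherent.
Variables (R : realType) (G : groupoid_data R).
Local Notation GG := (prod_groupoid G G).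
Local Notation GGG := (prod_groupoid GG G).
Variables (m : gfunctor GG G) (u : gfunctor point_groupoid G).

(* The functors m o (m x 1), m o (1 x m) : (G x G) x G -> G, and m o (u x 1),
   m o (1 x u) : G -> G. *)
Definition mul_left : gfunctor GGG G :=
  gfunctor_comp m (gpair (gfunctor_comp m (gfst GG G)) (gsnd GG G)).
Definition mul_right : gfunctor GGG G :=
  gfunctor_comp m (gpair (gfunctor_comp (gfst G G) (gfst GG G))
    (gfunctor_comp m (gpair (gfunctor_comp (gsnd G G) (gfst GG G)) (gsnd GG G)))).
Definition unit_mul : gfunctor G G :=
  gfunctor_comp m (gpair (gfunctor_comp u (gterminal G)) (gfunctor_id G)).
Definition mul_unit : gfunctor G G :=
  gfunctor_comp m (gpair (gfunctor_id G) (gfunctor_comp u (gterminal G))).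
End Coherent.

(* Coherent Lie 2-groups. *)
Record lie_2group (R : realType) := Lie2Group {
  l2g :> lie_groupoid R;
  l2_mul : gfunctor (prod_groupoid l2g l2g) l2g;
  l2_one : gfunctor point_groupoid l2g;
  l2_ass : gob (prod_groupoid (prod_groupoid l2g l2g) l2g) -> garr l2g;
  l2_lun : gob l2g -> garr l2g;
  l2_run : gob l2g -> garr l2g;
  mul_lie : is_lie_functor l2_mul;
  one_lie : is_lie_functor l2_one;
  mul_equiv : is_lie_equivalence (gpair (gfst l2g l2g) l2_mul);
  ass_nat : is_smooth_nat (mul_left l2_mul) (mul_right l2_mul) l2_ass;
  lun_nat : is_smooth_nat (unit_mul l2_mul l2_one) (gfunctor_id l2g) l2_lun;
  run_nat : is_smooth_nat (mul_unit l2_mul l2_one) (gfunctor_id l2g) l2_run;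
  l2g_pentagon : forall x y z w : gob l2g,
    gcomp (gf1 l2_mul (gid x, l2_ass (y, z, w)))
      (gcomp (l2_ass (x, gf0 l2_mul (y, z), w)) (gf1 l2_mul (l2_ass (x, y, z), gid w))) =
    gcomp (l2_ass (x, y, gf0 l2_mul (z, w))) (l2_ass (gf0 l2_mul (x, y), z, w));
  l2g_triangle : forall x y : gob l2g,
    gcomp (gf1 l2_mul (gid x, l2_lun y)) (l2_ass (x, gf0 l2_one 0, y)) =
    gf1 l2_mul (l2_run x, gid y) }.

Section Arrows.
Context {R : realType}.

(* The hom-sets of a groupoid. *)
Definition arrow (G : groupoid_data R) (x y : gob G) : Type :=
  {b : garr G | gsrc b = x /\ gtgt b = y}.

Lemma arrowP (G : groupoid_data R) (x y : gob G) (b c : arrow x y) :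
  sval b = sval c -> b = c.
Proof.
case: b c => b hb [c hc] /= bc; subst c; congr exist; exact: Prop_irrelevance.
Qed.

Variable G : lie_groupoid R.
Implicit Types x y z : gob G.

Definition arr (b : garr G) : arrow (gsrc b) (gtgt b) := exist _ b (conj erefl erefl).

Definition aid x : arrow x x :=
  exist _ (gid x) (conj (lg_src_id (lgP G) x) (lg_tgt_id (lgP G) x)).

Lemma acomp_proof x y z (b : arrow y z) (c : arrow x y) :
  gsrc (gcomp (sval b) (sval c)) = x /\ gtgt (gcomp (sval b) (sval c)) = z.
Proof.
case: b c => b [/= bs bt] [c [/= cs ct]].
have bc : composable b c by rewrite /composable bs ct.
by rewrite (lg_src_comp (lgP G) bc) (lg_tgt_comp (lgP G) bc).
Qed.
Definition acomp x y z (b : arrow y z) (c : arrow x y) : arrow x z :=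
  exist _ (gcomp (sval b) (sval c)) (acomp_proof b c).

Lemma ainv_proof x y (b : arrow x y) :
  gsrc (ginv (sval b)) = y /\ gtgt (ginv (sval b)) = x.
Proof.
by case: b => b [/= bs bt]; rewrite (lg_src_inv (lgP G)) (lg_tgt_inv (lgP G)).
Qed.
Definition ainv x y (b : arrow x y) : arrow y x :=
  exist _ (ginv (sval b)) (ainv_proof b).

Lemma acompA x y z w (b : arrow z w) (c : arrow y z) (d : arrow x y) :
  acomp b (acomp c d) = acomp (acomp b c) d.
Proof.
apply: arrowP; case: b c d => b [/= bs bt] [c [/= cs ct]] [d [/= ds dt]].
by apply: (lg_compA (lgP G)); rewrite /composable ?bs ?cs.
Qed.

Lemma acomp1l x y (b : arrow x y) : acomp (aid y) b = b.
Proof.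
apply: arrowP; case: b => b [/= _ bt].
by rewrite -[in LHS]bt (lg_comp1l (lgP G)).
Qed.

Lemma acomp1r x y (b : arrow x y) : acomp b (aid x) = b.
Proof.
apply: arrowP; case: b => b [/= bs _].
by rewrite -[in LHS]bs (lg_comp1r (lgP G)).
Qed.

Lemma acompVl x y (b : arrow x y) : acomp (ainv b) b = aid x.
Proof.
apply: arrowP; case: b => b [/= bs _].
by rewrite (lg_compVl (lgP G)) bs.
Qed.

Lemma acompVr x y (b : arrow x y) : acomp b (ainv b) = aid y.
Proof.
apply: arrowP; case: b => b [/= _ bt].
by rewrite (lg_compVr (lgP G)) bt.
Qed.
End Arrows.

Section Delooping.
Variables (R : realType) (G : lie_2group R).
Implicit Types x y z : gob G.

(* Multiplication of objects and of arrows, and the unit object.  The underlying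
   element of R^0 is its only element 0. *)
Definition omul x y : gob G := gf0 (l2_mul G) (x, y).
Definition oone : gob G := gf0 (l2_one G) 0.

Lemma amul_proof x x' y y' (b : arrow x x') (c : arrow y y') :
  gsrc (gf1 (l2_mul G) (sval b, sval c)) = omul x y /\
  gtgt (gf1 (l2_mul G) (sval b, sval c)) = omul x' y'.
Proof.
case: b c => b [/= bs bt] [c [/= cs ct]].
by rewrite (lf_src (mul_lie G)) (lf_tgt (mul_lie G)) /= bs bt cs ct.
Qed.
Definition amul x x' y y' (b : arrow x x') (c : arrow y y') :
    arrow (omul x y) (omul x' y') :=
  exist _ (gf1 (l2_mul G) (sval b, sval c)) (amul_proof b c).

Definition aass x y z : arrow (omul (omul x y) z) (omul x (omul y z)) :=
  exist _ (l2_ass (x, y, z))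
    (conj (sn_src (ass_nat G) (x, y, z)) (sn_tgt (ass_nat G) (x, y, z))).
Definition alun x : arrow (omul oone x) x :=
  exist _ (l2_lun x) (conj (sn_src (lun_nat G) x) (sn_tgt (lun_nat G) x)).
Definition arun x : arrow (omul x oone) x :=
  exist _ (l2_run x) (conj (sn_src (run_nat G) x) (sn_tgt (run_nat G) x)).

Lemma amul_id x y : amul (aid x) (aid y) = aid (omul x y).
Proof. by apply: arrowP; exact: (lf_id (mul_lie G) (x, y)). Qed.

Lemma amul_comp x x' x'' y y' y'' (b' : arrow x' x'') (b : arrow x x')
  (c' : arrow y' y'') (c : arrow y y') :
  amul (acomp b' b) (acomp c' c) = acomp (amul b' c') (amul b c).
Proof.
apply: arrowP; 
case: b' b c' c => b' [/= b's b't] [b [/= bs bt]] [c' [/= c's c't]].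
case=> c [/= cs ct].
have H : @composable _ (prod_groupoid G G) (b', c') (b, c).
  by rewrite /composable /= b's bt c's ct.
exact: (lf_comp (mul_lie G) H).
Qed.

Lemma aass_nat x x' y y' z z' (b : arrow x x') (c : arrow y y') (d : arrow z z') :
  acomp (aass x' y' z') (amul (amul b c) d) = acomp (amul b (amul c d)) (aass x y z).
Proof.
apply: arrowP; case: b c d => b [/= bs bt] [c [/= cs ct]] [d [/= ds dt]].
by rewrite -bs -bt -cs -ct -ds -dt; exact: (sn_nat (ass_nat G) (b, c, d)).
Qed.

Lemma alun_nat x x' (b : arrow x x') :
  acomp (alun x') (amul (aid oone) b) = acomp b (alun x).
Proof.
apply: arrowP; case: b => b [/= bs bt]; rewrite -bs -bt.
rewrite -(lf_id (one_lie G) 0); exact: (sn_nat (lun_nat G) b).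
Qed.

Lemma arun_nat x x' (b : arrow x x') :
  acomp (arun x') (amul b (aid oone)) = acomp b (arun x).
Proof.
apply: arrowP; case: b => b [/= bs bt]; rewrite -bs -bt.
rewrite -(lf_id (one_lie G) 0); exact: (sn_nat (run_nat G) b).
Qed.

(* The one-object bicategory B G. *)
Definition delooping : bicategory.
Proof.
refine (@Bicategory unit (fun _ _ => gob G) (fun _ _ => @arrow R G)
  (fun _ _ => @aid R G) (fun _ _ => @acomp R G)
  (fun _ => oone) (fun _ _ _ => omul) (fun _ _ _ f f' g g' => @amul f f' g g')
  (fun _ _ _ _ => aass) (fun _ _ _ _ f g h => ainv (aass f g h))
  (fun _ _ => alun) (fun _ _ f => ainv (alun f))
  (fun _ _ => arun) (fun _ _ f => ainv (arun f))
  _ _ _ _ _ _ _ _ _ _ _ _ _ _ _ _).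
- by move=> *; exact: acompA.
- by move=> *; exact: acomp1l.
- by move=> *; exact: acomp1r.
- by move=> *; exact: amul_id.
- by move=> *; exact: amul_comp.
- by move=> *; exact: acompVl.
- by move=> *; exact: acompVr.
- by move=> *; exact: acompVl.
- by move=> *; exact: acompVr.
- by move=> *; exact: acompVl.
- by move=> *; exact: acompVr.
- by move=> *; exact: aass_nat.
- by move=> *; exact: alun_nat.
- by move=> *; exact: arun_nat.
- by move=> *; apply: arrowP; exact: l2g_pentagon.
- by move=> *; apply: arrowP; exact: l2g_triangle.
Defined.
End Delooping.

(* The ground field is a finite field extension K of R, that is R itself or the
   field of complex numbers. *)
Section MatrixSmooth.
Variables (R : realType) (K : fieldExtType R).

(* For open W: smoothness of the real coordinates, in an R-basis of K, of all
   matrix entries. *)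
Definition smooth_mx (M : premanifold R) (W : set M) r s (h : M -> 'M[K]_(r, s)) : Prop :=
  forall c, atlas M c -> forall i j l,
    cinf [set z | ccod c z /\ W (cbwd c z)]
         (fun z => coord (vbasis {:K}) l (h (cbwd c z) i j)).

Lemma chart_preimage_open (M : premanifold R) (c : chart R M (mdim M)) (W : set M) :
  is_chart c -> open W -> open [set z | ccod c z /\ W (cbwd c z)].
Proof.
move=> hc oW; rewrite openE => z [cz Wz]; apply: filterI.
  by apply: open_nbhs_nbhs; split=> //; exact: ccod_open.
by apply: (cbwd_cont hc cz); apply: open_nbhs_nbhs.
Qed.

Section OneManifold.
Variables (M : premanifold R) (hM : is_manifold M).
Implicit Types (U W : set M).

Lemma smooth_mx_sub W U r s (h : M -> 'M[K]_(r, s)) :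
  U `<=` W -> smooth_mx W h -> smooth_mx U h.
Proof.
move=> UW H c hc i j l k; apply: td_sub (H c hc i j l k).
by move=> z [cz Uz]; split=> //; exact: UW.
Qed.

Lemma smooth_mx_ext W r s (h h' : M -> 'M[K]_(r, s)) : open W ->
  (forall p, W p -> h p = h' p) -> smooth_mx W h -> smooth_mx W h'.
Proof.
move=> oW e H c hc i j l k; apply: td_ext (H c hc i j l k).
  by apply: chart_preimage_open => //; exact: (manifold_chart hM).
by move=> z [_ Wz]; rewrite e.
Qed.

Lemma smooth_mx_local W r s (h : M -> 'M[K]_(r, s)) :
  (forall p, W p -> exists2 U, U p & smooth_mx (W `&` U) h) -> smooth_mx W h.
Proof.
move=> H c hc i j l k; apply: td_local => z [cz Wz].
have [U Uz HU] := H _ Wz; exists [set z | U (cbwd c z)] => //.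
apply: td_sub (HU c hc i j l k) => y [[cy Wy] Uy]; by split=> //; split.
Qed.

Lemma smooth_mxD W r s (h h' : M -> 'M[K]_(r, s)) : open W ->
  smooth_mx W h -> smooth_mx W h' -> smooth_mx W (fun p => h p + h' p).
Proof.
move=> oW H H' c hc i j l k.
have oU := chart_preimage_open (manifold_chart hM hc) oW.
apply: td_ext (tdD oU (H c hc i j l k) (H' c hc i j l k)) => // z _.
by rewrite mxE linearD.
Qed.

Lemma coordM (x y : K) l : coord (vbasis {:K}) l (x * y) =
  \sum_a \sum_b coord (vbasis {:K}) a x * coord (vbasis {:K}) b y *
     coord (vbasis {:K}) l ((vbasis {:K})`_a * (vbasis {:K})`_b).
Proof.
rewrite {1}(coord_vbasis (memvf x)) {1}(coord_vbasis (memvf y)).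
rewrite mulr_suml linear_sum; apply: eq_bigr => a _.
rewrite mulr_sumr linear_sum; apply: eq_bigr => b _.
by rewrite -scalerAl -scalerAr scalerA linearZ.
Qed.

Lemma smooth_mxM W r s t (h : M -> 'M[K]_(r, s)) (h' : M -> 'M[K]_(s, t)) : open W ->
  smooth_mx W h -> smooth_mx W h' -> smooth_mx W (fun p => h p *m h' p).
Proof.
move=> oW H H' c hc i j l k.
have oU := chart_preimage_open (manifold_chart hM hc) oW.
pose cd := coord (vbasis {:K}).
apply: (@td_ext _ _ _ _ (fun z => \sum_q \sum_a \sum_b
  (cd a (h (cbwd c z) i q) * cd b (h' (cbwd c z) q j)) *
  cd l ((vbasis {:K})`_a * (vbasis {:K})`_b))) => //.
  move=> z _; rewrite mxE linear_sum; apply: eq_bigr => q _.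
  exact: esym (coordM _ _ _).
apply: td_sum => // q; apply: td_sum => // a; apply: td_sum => // b.
apply: tdM => //; last exact: td_cst.
by apply: tdM => //; [exact: H|exact: H'].
Qed.

Lemma smooth_mx_cst W r s (A : 'M[K]_(r, s)) : smooth_mx W (fun=> A).
Proof. by move=> c hc i j l k; exact: td_cst. Qed.
End OneManifold.

Lemma smooth_mx_comp (M N : premanifold R) (W : set N) (f : M -> N) r s
    (h : N -> 'M[K]_(r, s)) : is_manifold M -> is_manifold N -> open W ->
  smooth f -> smooth_mx W h -> smooth_mx (f @^-1` W) (fun p => h (f p)).
Proof.
move=> hM hN oW [fc fs] H c hc i j l k; apply: td_local => z [cz Wz].
have [d hd dz] := manifold_cover hN (f (cbwd c z)).
have fcont : continuous f by move=> p; exact: fc.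
have oV : open (f @^-1` (W `&` cdom d)).
  have cd := manifold_chart hN hd.
  by apply: open_comp => [p _|]; [exact: fcont|apply: openI => //; exact: cdom_open cd].
exists [set z | ccod c z /\ (f @^-1` (W `&` cdom d)) (cbwd c z)]; first by [].
set U := _ `&` _.
have UE : U = [set z | ccod c z /\ (f @^-1` (W `&` cdom d)) (cbwd c z)].
  by apply/seteqP; split=> y /=; [case|case=> ? [? ?]].
have oU : open U.
  by rewrite UE; apply: chart_preimage_open => //; exact: (manifold_chart hM).
have hdc := manifold_chart hN hd.
apply: (@td_ext _ _ _ _ (fun z => coord (vbasis {:K}) l
   (h (cbwd d (cfwd d (f (cbwd c z)))) i j))) => //.
  by move=> y; rewrite UE => -[_ [_ dy]]; rewrite (cfwdK hdc).
apply: (@td_comp _ _ _ _ _ [set z | ccod d z /\ W (cbwd d z)]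
  (fun z => cfwd d (f (cbwd c z)))
  (fun z => coord (vbasis {:K}) l (h (cbwd d z) i j))) => //.
- move=> y; rewrite UE => -[_ [Wy dy]]; split; first exact: cfwd_cod.
  by rewrite /= (cfwdK hdc).
- move=> q; apply: td_sub (fs c d hc hd q k) => y; rewrite UE => -[cy [_ dy]].
  by split.
- exact: H.
Qed.

Lemma smooth_partial (M N P : premanifold R) (f : M * N -> P) (q : N) :
  is_manifold M -> is_manifold N -> is_manifold P ->
  smooth (f : prod_manifold M N -> P) -> smooth (fun p => f (p, q)).
Proof.
move=> hM hN hP [fc fs].
have fq : continuous (fun p => f (p, q)).
  move=> p.
  have cq : {for p, continuous (fun p : M => (p, q))}.
    by apply: cvg_pair; [exact: cvg_id|exact: cvg_cst].
  exact: (continuous_comp cq (fc (p, q) I)).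
split=> [p _|c e hc he i k]; first exact: fq.
have [d hd dq] := manifold_cover hN q.
have hdc := manifold_chart hN hd.
set U := (X in times_differentiable _ X _).
have oU : open U.
  have -> : U = [set z | ccod c z /\ ((fun p => f (p, q)) @^-1` (cdom e)) (cbwd c z)].
    by apply/seteqP; split=> y /=; [case=> ? []|case].
  apply: chart_preimage_open; first exact: (manifold_chart hM).
  apply: open_comp => [p _|]; first exact: fq.
  exact: cdom_open (manifold_chart hP he).
have E y : cbwd (prod_chart c d) (row_mx y (cfwd d q)) = (cbwd c y, q).
  by rewrite /= row_mxKl row_mxKr (cfwdK hdc).
have := fs (prod_chart c d) e _ he i k.
move=> /(_ (ex_intro _ c (ex_intro _ d (And3 hc hd erefl)))) H.
have -> : (fun x => cfwd e (f (cbwd c x, q)) 0 i) =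
          (fun x => cfwd e (f (cbwd (prod_chart c d) (row_mx x (cfwd d q)))) 0 i).
  by apply/funext => y; rewrite E.
apply: (@td_comp _ _ _ _ _ _ (fun x => row_mx x (cfwd d q))
  (fun z => cfwd e (f (cbwd (prod_chart c d) z)) 0 i) oU _ _ H).
- move=> y [cy [_ ey]]; split.
    by rewrite /= row_mxKl row_mxKr; split=> //; exact: cfwd_cod.
  by rewrite E; split.
- move=> j; case: (splitP j) => a ja.
    have -> : j = lshift _ a by exact: val_inj.
    have -> : (fun x : 'rV[R]_(mdim M) => row_mx x (cfwd d q) 0 (lshift _ a)) =
             (fun x => x 0 a).
      by apply/funext => x; rewrite row_mxEl.
    exact: td_coord.
  have -> : j = rshift _ a by exact: val_inj.
  have -> : (fun x : 'rV[R]_(mdim M) => row_mx x (cfwd d q) 0 (rshift _ a)) =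
           cst (cfwd d q 0 a).
    by apply/funext => x; rewrite row_mxEr.
  exact: td_cst.
Qed.

Lemma lin1_mx_comp r s t (f : 'rV[K]_r -> 'rV[K]_s) (g : 'rV[K]_s -> 'rV[K]_t) :
  linear g -> lin1_mx (g \o f) = lin1_mx f *m lin1_mx g.
Proof.
move=> lg; pose g' : {linear 'rV[K]_s -> 'rV[K]_t} :=
  HB.pack g (GRing.isLinear.Build _ _ _ _ _ lg).
apply/row_matrixP => i; rewrite row_mul.
have E a b (q : 'rV[K]_a -> 'rV[K]_b) k : row k (lin1_mx q) = q (delta_mx 0 k).
  by apply/rowP => j; rewrite !mxE.
by rewrite !E -[g]/(g' : _ -> _) mul_rV_lin1.
Qed.
End MatrixSmooth.

Section Bundles.
Variables (R : realType) (K : fieldExtType R).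

(* A vector bundle is given by its fibres and a bundle atlas: local
   trivialisations fibre x ~ K^r, for x in [vb_dom i], with inverse [vb_section i],
   and smooth transition matrices.  The rank is only locally constant. *)
Record vector_bundle (M : premanifold R) := VectorBundle {
  fibre :> M -> lmodType K;
  vb_index : Type;
  vb_dom : vb_index -> set M;
  vb_rank : vb_index -> nat;
  vb_triv : forall i x, fibre x -> 'rV[K]_(vb_rank i);
  vb_section : forall i x, 'rV[K]_(vb_rank i) -> fibre x;
  vb_dom_open : forall i, open (vb_dom i);
  vb_cover : forall x, exists i, vb_dom i x;
  vb_triv_linear : forall i x, vb_dom i x -> linear (@vb_triv i x);
  vb_trivK : forall i x, vb_dom i x -> cancel (@vb_triv i x) (@vb_section i x);
  vb_sectionK : forall i x, vb_dom i x -> cancel (@vb_section i x) (@vb_triv i x);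
  vb_transition_smooth : forall i j,
    smooth_mx (vb_dom i `&` vb_dom j)
      (fun x => lin1_mx (@vb_triv j x \o @vb_section i x)) }.

Arguments vb_dom {M} V i : rename.
Arguments vb_rank {M} V i : rename.
Arguments vb_triv {M} V i x : rename.
Arguments vb_section {M} V i x : rename.

(* The matrix (acting on row vectors) of a linear map between two fibres read in
   local trivialisations.  The local trivialisations i and j, together with the
   base points x and y and this matrix, are the charts of the Lie groupoid of
   linear isomorphisms between fibres. *)
Definition local_matrix (M : premanifold R) (V W : vector_bundle M) i j x y
    (f : V x -> W y) : 'M[K]_(vb_rank V i, vb_rank W j) :=
  lin1_mx (vb_triv W j y \o f \o vb_section V i x).

Definition smooth_bundle_map (M : premanifold R) (V W : vector_bundle M)
    (f : forall x, V x -> W x) : Prop :=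
  forall i j, smooth_mx (vb_dom V i `&` vb_dom W j)
                        (fun x => local_matrix i j (f x)).
Variable G : lie_groupoid R.

(* [rep_act] is a functor from G to the groupoid of linear isomorphisms between
   fibres of the bundle, smooth in the charts above; rep_act b is invertible because
   b is. *)
Record representation := Representation {
  rep_bundle :> vector_bundle (gob G);
  rep_act : forall x y, arrow x y -> rep_bundle x -> rep_bundle y;
  rep_act_linear : forall x y (b : arrow x y), linear (rep_act b);
  rep_act_id : forall x v, rep_act (aid x) v = v;
  rep_act_comp : forall x y z (b : arrow y z) (c : arrow x y) v,
    rep_act (acomp b c) v = rep_act b (rep_act c v);
  rep_act_smooth : forall i j,
    smooth_mx [set b : garr G | vb_dom rep_bundle i (gsrc b) /\
                                vb_dom rep_bundle j (gtgt b)]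
      (fun b => local_matrix i j (rep_act (arr b))) }.

Arguments rep_act V [x y] b v : rename.

Record rep_hom (V W : representation) := RepHom {
  rep_map :> forall x, V x -> W x;
  rep_map_linear : forall x, linear (rep_map (x := x));
  rep_map_equivariant : forall x y (b : arrow x y) v,
    rep_map (rep_act V b v) = rep_act W b (rep_map v);
  rep_map_smooth : smooth_bundle_map rep_map }.

Lemma rep_homP (V W : representation) (f g : rep_hom V W) :
  (forall x v, f x v = g x v) -> f = g.
Proof.
case: f g => f fl fe fs [g gl ge gs] /= fg.
have E : f = g by apply: functional_extensionality_dep => x; exact/funext.
by subst g; congr RepHom; exact: Prop_irrelevance.
Qed.


Let hM : is_manifold (gob G) := lg_ob_manifold (lgP G).

Let oI (V W : vector_bundle (gob G)) i j : open (vb_dom V i `&` vb_dom W j).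
Proof. by apply: openI; exact: vb_dom_open. Qed.

Lemma smooth_bundle_map_comp (V W X : vector_bundle (gob G))
    (g : forall x, W x -> X x) (f : forall x, V x -> W x) :
  (forall x, linear (g x)) ->
  smooth_bundle_map f -> smooth_bundle_map g ->
  smooth_bundle_map (fun x => g x \o f x).
Proof.
move=> lg Hf Hg i k; apply: smooth_mx_local => p [ip kp].
have [j jp] := vb_cover W p; exists (vb_dom W j) => //.
set U := _ `&` _.
have oU : open U by apply: openI => //; exact: vb_dom_open.
apply: (smooth_mx_ext hM oU
  (h := fun x => local_matrix i j (f x) *m local_matrix j k (g x))).
  move=> x [[_ kx] jx]; rewrite /local_matrix -lin1_mx_comp.
    by congr lin1_mx; apply/funext => v /=; rewrite vb_trivK.
  have sl : linear (vb_section W j x).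
    move=> a u v; apply: (can_inj (vb_trivK jx)).
    by rewrite (vb_triv_linear jx) !(vb_sectionK jx).
  by move=> a u v /=; rewrite sl lg (vb_triv_linear kx).
apply: (smooth_mxM hM oU).
  by apply: smooth_mx_sub (Hf i j) => x [[]].
by apply: smooth_mx_sub (Hg j k) => x [[]].
Qed.

Lemma smooth_bundle_map_lin (V W : vector_bundle (gob G))
    (f g : forall x, V x -> W x) (a : K) :
  smooth_bundle_map f -> smooth_bundle_map g ->
  smooth_bundle_map (fun x v => a *: f x v + g x v).
Proof.
move=> Hf Hg i j.
apply: (smooth_mx_ext hM (@oI V W i j)
  (h := fun x => local_matrix i j (f x) *m a%:M + local_matrix i j (g x))).
  move=> x [_ jx]; apply/matrixP => p q.
  by rewrite mul_mx_scalar !mxE /= (vb_triv_linear jx) !mxE.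
apply: (smooth_mxD hM (@oI V W i j)) => //.
by apply: (smooth_mxM hM (@oI V W i j)) => //; exact: smooth_mx_cst.
Qed.

Lemma smooth_bundle_map0 (V W : vector_bundle (gob G)) :
  smooth_bundle_map (fun x (_ : V x) => 0 : W x).
Proof.
move=> i j; apply: (smooth_mx_ext hM (@oI V W i j) (h := fun=> 0)).
  move=> x [_ jx]; apply/matrixP => p q; rewrite !mxE /=.
  have := vb_triv_linear jx (-1) 0 0; rewrite scaler0 addr0 scaleN1r addNr => ->.
  by rewrite mxE.
exact: smooth_mx_cst.
Qed.

Definition rep_hom_id (V : representation) : rep_hom V V.
Proof.
by exists (fun x => id) => // i j; exact: vb_transition_smooth.
Defined.

Definition rep_hom_comp (V W X : representation) (g : rep_hom W X) (f : rep_hom V W) :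
  rep_hom V X.
Proof.
exists (fun x => g x \o f x).
- by move=> x a u v /=; rewrite !rep_map_linear.
- by move=> x y b v /=; rewrite !rep_map_equivariant.
- by apply: smooth_bundle_map_comp; [exact: rep_map_linear|exact: rep_map_smooth..].
Defined.

Lemma rep_act0 (W : representation) x y (b : arrow x y) : rep_act W b 0 = 0.
Proof.
by have := rep_act_linear (r:=W) b (-1) 0 0;
   rewrite scaler0 addr0 scaleN1r addNr.
Qed.

Definition rep_hom0 (V W : representation) : rep_hom V W.
Proof.
exists (fun x _ => 0).
- by move=> x a u v; rewrite scaler0 addr0.
- by move=> x y b v; rewrite rep_act0.
- exact: smooth_bundle_map0.
Defined.

(* The pointwise combination a f + g. *)
Definition rep_hom_lin (V W : representation) (a : K) (f g : rep_hom V W) : rep_hom V W.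
Proof.
exists (fun x v => a *: f x v + g x v).
- move=> x c u v; rewrite !rep_map_linear !scalerDr !scalerA [a * c]mulrC.
  by rewrite -!addrA; congr (_ + _); rewrite addrCA.
- by move=> x y b v; rewrite rep_act_linear !rep_map_equivariant.
- by apply: smooth_bundle_map_lin; exact: rep_map_smooth.
Defined.

HB.instance Definition _ V W := gen_eqMixin (rep_hom V W).
HB.instance Definition _ V W := gen_choiceMixin (rep_hom V W).

Section RepHomLmodule.
Variables V W : representation.
Definition rep_hom_add (f g : rep_hom V W) := rep_hom_lin 1 f g.
Definition rep_hom_scale (a : K) (f : rep_hom V W) := rep_hom_lin a f (rep_hom0 V W).
Definition rep_hom_opp (f : rep_hom V W) := rep_hom_scale (-1) f.

Lemma rep_hom_addE f g x v : rep_hom_add f g x v = f x v + g x v.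
Proof. by rewrite /= scale1r. Qed.
Lemma rep_hom_scaleE a f x v : rep_hom_scale a f x v = a *: f x v.
Proof. by rewrite /= addr0. Qed.
Lemma rep_hom_oppE f x v : rep_hom_opp f x v = - f x v.
Proof. by rewrite rep_hom_scaleE scaleN1r. Qed.

Fact rep_hom_addA : associative rep_hom_add.
Proof. by move=> f g h; apply: rep_homP => x v; rewrite !rep_hom_addE addrA. Qed.
Fact rep_hom_addC : commutative rep_hom_add.
Proof. by move=> f g; apply: rep_homP => x v; rewrite !rep_hom_addE addrC. Qed.
Fact rep_hom_add0 : left_id (rep_hom0 V W) rep_hom_add.
Proof. by move=> f; apply: rep_homP => x v; rewrite !rep_hom_addE add0r. Qed.
Fact rep_hom_addN : left_inverse (rep_hom0 V W) rep_hom_opp rep_hom_add.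
Proof. by move=> f; apply: rep_homP => x v; rewrite rep_hom_addE rep_hom_oppE addNr. Qed.
HB.instance Definition _ := GRing.isZmodule.Build (rep_hom V W)
  rep_hom_addA rep_hom_addC rep_hom_add0 rep_hom_addN.

Fact rep_hom_scaleA a b f : rep_hom_scale a (rep_hom_scale b f) = rep_hom_scale (a * b) f.
Proof. by apply: rep_homP => x v; rewrite !rep_hom_scaleE scalerA. Qed.
Fact rep_hom_scale1 : left_id 1 rep_hom_scale.
Proof. by move=> f; apply: rep_homP => x v; rewrite rep_hom_scaleE scale1r. Qed.
Fact rep_hom_scaleDr : right_distributive rep_hom_scale +%R.
Proof.
move=> a f g; apply: rep_homP => x v.
by rewrite [RHS]rep_hom_addE !rep_hom_scaleE rep_hom_addE scalerDr.
Qed.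
Fact rep_hom_scaleDl f : {morph rep_hom_scale^~ f : a b / a + b}.
Proof.
move=> a b; apply: rep_homP => x v.
by rewrite [RHS]rep_hom_addE !rep_hom_scaleE scalerDl.
Qed.
HB.instance Definition _ := GRing.Zmodule_isLmodule.Build K (rep_hom V W)
  rep_hom_scaleA rep_hom_scale1 rep_hom_scaleDr rep_hom_scaleDl.

Lemma rep_hom_linE a (f g : rep_hom V W) x v : (a *: f + g) x v = a *: f x v + g x v.
Proof. by rewrite [LHS]rep_hom_addE rep_hom_scaleE. Qed.
End RepHomLmodule.

(* The K-linear category of representations of G. *)
Definition Rep : lincat K.
Proof.
refine (@LinCat K representation (fun V W => rep_hom V W : lmodType K)
  rep_hom_id rep_hom_comp _ _ _ _ _).
- by move=> V W X Y h g f; exact: rep_homP.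
- by move=> V W f; exact: rep_homP.
- by move=> V W f; exact: rep_homP.
- move=> V W X f a g h; apply: rep_homP => x v.
  by rewrite [RHS]rep_hom_linE; exact: rep_hom_linE.
- move=> V W X g a f h; apply: rep_homP => x v.
  rewrite [RHS]rep_hom_linE -[RHS](rep_map_linear g a (f x v) (h x v)).
  by congr (g x _); exact: rep_hom_linE.
Defined.

End Bundles.

Arguments vb_dom {R K M} V i : rename.
Arguments vb_rank {R K M} V i : rename.
Arguments vb_triv {R K M} V i x : rename.
Arguments vb_section {R K M} V i x : rename.
Arguments rep_act {R K G} V [x y] b v : rename.

Section RightTranslation.
Variables (R : realType) (K : fieldExtType R) (G : lie_2group R).
Local Notation rep := (representation K G).
Local Notation bundle := (vector_bundle K (gob G)).

Lemma omul_smooth (g : gob G) : smooth (fun x : gob G => omul x g : gob G).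
Proof.
have h := lg_ob_manifold (lgP G).
exact: (smooth_partial g h h h (lf_ob_smooth (mul_lie G))).
Qed.

Lemma amulr_smooth (g1 : garr G) :
  smooth (fun b : garr G => gf1 (l2_mul G) (b, g1) : garr G).
Proof.
have h := lg_arr_manifold (lgP G).
exact: (smooth_partial g1 h h h (lf_arr_smooth (mul_lie G))).
Qed.

(* Pullback of the bundle along right translation x |-> x o g; its fibre at x is
   V (x o g), and the local trivialisations are those of V. *)
Definition bundle_shift (g : gob G) (V : bundle) : bundle.
Proof.
exists (fun x => V (omul x g)) (vb_index V)
  (fun i => [set x | vb_dom V i (omul x g)]) (vb_rank V)
  (fun i x => vb_triv V i (omul x g)) (fun i x => vb_section V i (omul x g)).
- move=> i; apply: (@open_comp _ _ (fun x => omul x g) (vb_dom V i)).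
    by move=> x _; have [+ _] := omul_smooth g; exact.
  exact: vb_dom_open.
- by move=> x; exact: vb_cover.
- by move=> i x; exact: vb_triv_linear.
- by move=> i x; exact: vb_trivK.
- by move=> i x; exact: vb_sectionK.
- move=> i j; have h := lg_ob_manifold (lgP G).
  have o : open (vb_dom V i `&` vb_dom V j) by apply: openI; exact: vb_dom_open.
  exact: (smooth_mx_comp h h o (omul_smooth g) (@vb_transition_smooth _ _ _ V i j)).
Defined.

Lemma act_matrixE (V : rep) i j x y (b : arrow x y) :
  local_matrix i j (rep_act V b) = local_matrix i j (rep_act V (arr (sval b))).
Proof. by case: b => b [e1 e2] /=; case: _ / e1; case: _ / e2. Qed.

Let act_dom_open (V : rep) i j :
  open [set b : garr G | vb_dom V i (gsrc b) /\ vb_dom V j (gtgt b)].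
Proof.
have [cs _] := lg_src_smooth (lgP G); have [ct _] := lg_tgt_smooth (lgP G).
apply: openI; (apply: open_comp => [p _|]; last exact: vb_dom_open).
  exact: cs.
exact: ct.
Qed.

(* F_g(V)(b) = V(b . 1_g). *)
Definition F_ob (g : gob G) (V : rep) : rep.
Proof.
exists (bundle_shift g V) (fun x y b => rep_act V (amul b (aid g))).
- by move=> x y b; exact: rep_act_linear.
- by move=> x v; rewrite amul_id; exact: rep_act_id.
- by move=> x y z b c v; rewrite -{1}(acomp1l (aid g)) amul_comp; exact: rep_act_comp.
- move=> i j; have h := lg_arr_manifold (lgP G).
  have := smooth_mx_comp h h (@act_dom_open V i j) (amulr_smooth (gid g))
     (@rep_act_smooth _ _ _ V i j).
  set A := _ @^-1` _; set B := [set b | _].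
  have -> : A = B.
    apply/seteqP; split=> b;
    rewrite /A /B /= (lf_src (mul_lie G)) (lf_tgt (mul_lie G)) /=;
    by rewrite (lg_src_id (lgP G)) (lg_tgt_id (lgP G)).
  congr smooth_mx; apply/funext => b.
  exact: esym (@act_matrixE V i j _ _ (amul (arr b) (aid g))).
Defined.

Definition F_hom (g : gob G) (V W : rep) (f : rep_hom V W) :
  rep_hom (F_ob g V) (F_ob g W).
Proof.
exists (fun x => f (omul x g)).
- by move=> x a u v; exact: (rep_map_linear f a u v).
- by move=> x y b v; exact: (rep_map_equivariant f (amul b (aid g)) v).
- move=> i j; have h := lg_ob_manifold (lgP G).
  have o : open (vb_dom V i `&` vb_dom W j) by apply: openI; exact: vb_dom_open.
  exact: (smooth_mx_comp h h o (omul_smooth g) (@rep_map_smooth _ _ _ _ _ f i j)).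
Defined.

Definition F_functor (g : gob G) : linfunctor (Rep K G) (Rep K G).
Proof.
exists (F_ob g) (F_hom g).
- move=> V W a f f'; apply: rep_homP => x v.
  rewrite [RHS]rep_hom_linE.
  exact: (rep_hom_linE a (f : rep_hom V W) f' (x := omul x g) v).
- by move=> V; exact: rep_homP.
- by move=> V W X f f'; exact: rep_homP.
Defined.

(* F_{g1}(V)_x = V(1_x . g1). *)
Definition F_arrow_comp (g g' : gob G) (g1 : arrow g g') (V : rep) :
  rep_hom (F_ob g V) (F_ob g' V).
Proof.
exists (fun x => rep_act V (amul (aid x) g1)).
- by move=> x a u v; exact: (rep_act_linear (amul (aid x) g1) a u v).
- move=> x y b v /=; rewrite -!rep_act_comp -!amul_comp.
  by rewrite !acomp1l !acomp1r.
- move=> i j; have h := lg_ob_manifold (lgP G); have h1 := lg_arr_manifold (lgP G).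
  have o := @act_dom_open V i j.
  have H := smooth_mx_comp h1 h1 o (amulr_smooth (sval g1)) (@rep_act_smooth _ _ _ V i j).
  have o' : open ((fun b => gf1 (l2_mul G) (b, sval g1)) @^-1`
     [set b : garr G | vb_dom V i (gsrc b) /\ vb_dom V j (gtgt b)]).
    apply: open_comp o => b _; have [+ _] := amulr_smooth (sval g1); exact.
  have := smooth_mx_comp h h1 o' (lg_id_smooth (lgP G)) H.
  set A := _ @^-1` _; set B := _ `&` _.
  have -> : A = B.
    case: g1 @A {H o'} => g1 [s1 t1] A.
    apply/seteqP; split=> x;
    rewrite /A /B /= (lf_src (mul_lie G)) (lf_tgt (mul_lie G)) /=;
    by rewrite (lg_src_id (lgP G)) (lg_tgt_id (lgP G)) s1 t1.
  congr smooth_mx; apply/funext => x.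
  exact: esym (@act_matrixE V i j _ _ (amul (aid x) g1)).
Defined.

Definition F_arrow (g g' : gob G) (g1 : arrow g g') :
  nattrans (F_functor g) (F_functor g').
Proof.
exists (F_arrow_comp g1) => V W f; apply: rep_homP => x v /=.
by rewrite rep_map_equivariant.
Defined.

End RightTranslation.

(* Main.v *)
Require Import Defs.
From mathcomp Require Import all_boot all_order all_algebra all_field.
From mathcomp Require Import all_classical all_reals all_analysis.
Set Implicit Arguments. Unset Strict Implicit. Unset Printing Implicit Defensive.
Import GRing.Theory.
Import numFieldNormedType.Exports.
Local Open Scope classical_set_scope.
Local Open Scope ring_scope.

(** The functor [F_g] is the pullback of representations along right translation
    x |-> x o g, and [F_{g1}] is the action of the arrows 1_x . g1.  The remaining
    structure of the pseudofunctor also consists of arrows of G through which each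
    representation V acts.  The fibre of F_f (F_g V) at x is that of V at
    (x o f) o g, while the fibre of F_{f o g} V is that of V at x o (f o g), so the
    associator a_{x,f,g} gives the compositor F_f F_g => F_{f o g}; likewise the
    inverse right unitor x -> x o 1 gives the unit constraint id => F_1.

    As V is a functor, each axiom of a pseudofunctor becomes an identity between
    arrows of G.  Naturality of the constraints, and equivariance of their
    components, is naturality of the associator and of the right unitor.
    Compatibility with associativity is the pentagon identity at (x, f, g, h).
    Compatibility with the left unit is the triangle identity at (x, f).
    Compatibility with the right unit is (1_x . r_f) a_{x,f,1} = r_{x o f}, which is
    not an axiom of a 2-group but follows from the pentagon and the triangle in
    every bicategory ([bicat_runitor_hcomp]).

    The analytic content is that the components are smooth bundle maps.  An arrow
    u_x : s x -> t x that depends smoothly on x acts smoothly in local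
    trivialisations ([smooth_rep_act_family]).  For u_x = a_{x,f,g} the smoothness
    comes from that of the associator on (G_0 x G_0) x G_0, by freezing two of the
    three variables; freezing the outer one uses that G_0 x G_0 is a manifold
    ([is_manifold_prod]). *)

(** * Products and composites of smooth maps *)

Lemma hausdorff_prod (T U : topologicalType) :
  hausdorff_space T -> hausdorff_space U -> hausdorff_space (T * U)%type.
Proof.
move=> hT hU [x y] [x' y'] cl; congr pair.
  apply: hT => A B Ax Bx'.
  have nA : nbhs (x, y) (A `*` setT) by exists (A, setT) => //; split=> //; exact: filterT.
  have nB : nbhs (x', y') (B `*` setT) by exists (B, setT) => //; split=> //; exact: filterT.
  by have [[a b] [[Aa _] [Ba _]]] := cl _ _ nA nB; exists a.
apply: hU => A B Ay By'.
have nA : nbhs (x, y) (setT `*` A) by exists (setT, A) => //; split=> //; exact: filterT.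
have nB : nbhs (x', y') (setT `*` B) by exists (setT, B) => //; split=> //; exact: filterT.
by have [[a b] [[_ Ab] [_ Bb]]] := cl _ _ nA nB; exists b.
Qed.

Lemma open_setX (T U : topologicalType) (A : set T) (B : set U) :
  open A -> open B -> open (A `*` B).
Proof.
rewrite !openE => oA oB [x y] [Ax By]; exists (A, B) => //.
by split; [exact: oA|exact: oB].
Qed.

Lemma second_countable_prod (T U : topologicalType) :
  @second_countable T -> @second_countable U -> @second_countable (T * U)%type.
Proof.
move=> [B cB [oB nB]] [C cC [oC nC]].
exists [set D.1 `*` D.2 | D in B `*` C].
  exact: card_le_trans (card_image_le _ _) (countableX cB cC).
split=> [_ [[D E] [/= BD CE] <-]|[x y] A [[P Q] [/= nP nQ] PQA]].
  by apply: open_setX; [exact: oB|exact: oC].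
have [D [BD Dx] DP] := nB x P nP; have [E [CE Ey] EQ] := nC y Q nQ.
exists (D `*` E); first by split; [exists (D, E)|].
by move=> [a b] [/= /DP Pa /EQ Qb]; apply: PQA.
Qed.

Lemma continuous_row_mx (K : numFieldType) (T : topologicalType) r m n
    (f : T -> 'M[K]_(r, m)) (g : T -> 'M[K]_(r, n)) (p : T) :
  {for p, continuous f} -> {for p, continuous g} ->
  {for p, continuous (fun q => row_mx (f q) (g q))}.
Proof.
move=> fc gc A [P nP PA].
suff nPp i j : nbhs p [set q | P i j (row_mx (f q) (g q) i j)].
  have : \forall q \near p, forall i j, P i j (row_mx (f q) (g q) i j).
    by apply: filter_forall => i; apply: filter_forall => j; exact: nPp.
  by apply: filterS => q Pq; exact: PA.
case: (splitP j) => a ja.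
  have -> : j = lshift _ a by exact: val_inj.
  have := nP i (lshift _ a); rewrite row_mxEl => /coord_continuous/fc H.
  by apply: (@filterS _ (nbhs p) _ _ _ _ H) => q /=; rewrite row_mxEl.
have -> : j = rshift _ a by exact: val_inj.
have := nP i (rshift _ a); rewrite row_mxEr => /coord_continuous/gc H.
by apply: (@filterS _ (nbhs p) _ _ _ _ H) => q /=; rewrite row_mxEr.
Qed.

Section SmoothMaps.
Variable R : realType.
Implicit Types M N P : premanifold R.

(** Near z both sides are read in a chart d of N around f z: in charts, g o f is the
    composite of the local expressions of g and f through d. *)
Lemma smooth_comp M N P (g : N -> P) (f : M -> N) :
  is_manifold M -> is_manifold N -> is_manifold P ->
  smooth f -> smooth g -> smooth (g \o f).
Proof.
move=> hM hN hP [fc fs] [gc gs].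
have gfc : continuous (g \o f).
  by move=> p; apply: continuous_comp; [exact: fc|exact: gc].
split=> [p _|c e hc he i k]; first exact: gfc.
apply: td_local => z [cz [_ ez]].
have [d hd dz] := manifold_cover hN (f (cbwd c z)).
have hdc := manifold_chart hN hd.
pose V := f @^-1` cdom d `&` (g \o f) @^-1` cdom e.
have oV : open V.
  apply: openI; apply: open_comp.
  - by move=> p _; exact: fc.
  - exact: cdom_open hdc.
  - by move=> p _; exact: gfc.
  - exact: cdom_open (manifold_chart hP he).
exists [set y | V (cbwd c y)]; first by [].
set U := _ `&` _.
have UE : U = [set y | ccod c y /\ V (cbwd c y)].
  by apply/seteqP; split=> y; [move=> [[? _] ?]|move=> [? [? ?]]].
have oU : open U.
  by rewrite UE; apply: chart_preimage_open => //; exact: (manifold_chart hM).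
apply: (@td_ext _ _ _ _ (fun y => cfwd e (g (cbwd d (cfwd d (f (cbwd c y))))) 0 i)) => //.
  by move=> y; rewrite UE => -[_ [dy _]]; rewrite (cfwdK hdc).
apply: (@td_comp _ _ _ _ _ _ (fun y => cfwd d (f (cbwd c y)))
  (fun y => cfwd e (g (cbwd d y)) 0 i) oU _ _ (gs d e hd he i k)).
  move=> y; rewrite UE => -[_ [dy ey]]; split; first exact: cfwd_cod.
  by rewrite (cfwdK hdc).
move=> j; apply: td_sub (fs c d hc hd j k) => y; rewrite UE => -[cy [dy _]].
by split.
Qed.

Lemma is_chart_prod (T U : topologicalType) m n (c : chart R T m) (d : chart R U n) :
  is_chart c -> is_chart d -> is_chart (prod_chart c d).
Proof.
move=> hc hd; split=> /=.
- exact: open_setX (cdom_open hc) (cdom_open hd).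
- apply: openI.
    apply: (@open_comp _ _ lsubmx (ccod c)) (ccod_open hc) => z _.
    exact: continuous_lsubmx.
  apply: (@open_comp _ _ rsubmx (ccod d)) (ccod_open hd) => z _.
  exact: continuous_rsubmx.
- by move=> p [cp dp]; rewrite row_mxKl row_mxKr; split; exact: cfwd_cod.
- by move=> z [cz dz]; split; exact: cbwd_dom.
- by move=> [p q] [/= cp dq]; rewrite row_mxKl row_mxKr !cfwdK.
- by move=> z [cz dz]; rewrite !cbwdK ?hsubmxK.
- move=> p [cp dp]; apply: continuous_row_mx.
    apply: (@continuous_comp _ _ _ fst (cfwd c)); first exact: cvg_fst.
    exact: (cfwd_cont hc).
  apply: (@continuous_comp _ _ _ snd (cfwd d)); first exact: cvg_snd.
  exact: (cfwd_cont hd).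
- move=> z [cz dz].
  have cl : {for z, continuous (cbwd c \o lsubmx)}.
    by apply: continuous_comp; [exact: continuous_lsubmx|exact: (cbwd_cont hc)].
  have cr : {for z, continuous (cbwd d \o rsubmx)}.
    by apply: continuous_comp; [exact: continuous_rsubmx|exact: (cbwd_cont hd)].
  exact: cvg_pair cl cr.
Qed.

Lemma td_lsubmx m n k (W : set 'rV[R]_(m + n)) j :
  times_differentiable k W (fun z => lsubmx z 0 j).
Proof.
have -> : (fun z : 'rV[R]_(m + n) => lsubmx z 0 j) = fun z => z 0 (lshift n j).
  by apply/funext => z; rewrite mxE.
exact: td_coord.
Qed.

Lemma td_rsubmx m n k (W : set 'rV[R]_(m + n)) j :
  times_differentiable k W (fun z => rsubmx z 0 j).
Proof.
have -> : (fun z : 'rV[R]_(m + n) => rsubmx z 0 j) = fun z => z 0 (rshift m j).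
  by apply/funext => z; rewrite mxE.
exact: td_coord.
Qed.

(** The transition map between two product charts has block components, each of
    which is a transition map of one factor precomposed with a linear projection. *)
Lemma is_manifold_prod M N :
  is_manifold M -> is_manifold N -> is_manifold (prod_manifold M N).
Proof.
move=> hM hN.
have chartMN e : atlas (prod_manifold M N) e -> is_chart e.
  by move=> [c [d [hc hd ->]]];
    apply: is_chart_prod; [exact: (manifold_chart hM)|exact: (manifold_chart hN)].
split=> //.
- exact: hausdorff_prod (manifold_hausdorff hM) (manifold_hausdorff hN).
- exact: second_countable_prod (manifold_second_countable hM)
    (manifold_second_countable hN).
- move=> [p q]; have [c hc cp] := manifold_cover hM p.
  have [d hd dq] := manifold_cover hN q.
  by exists (prod_chart c d) => //; exists c, d.
move=> e e' he he'; have oU := chart_preimage_open (chartMN e he)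
  (cdom_open (chartMN e' he')).
case: he oU => c [d [hc hd ->]]; case: he' => c' [d' [hc' hd' ->]] oU i k.
case: (splitP i) => a ia.
  have -> : i = lshift _ a by exact: val_inj.
  apply: td_ext oU _ (@td_comp _ _ _ _ _ _ lsubmx
    (fun y => cfwd c' (cbwd c y) 0 a) oU _ _ (manifold_compat hM hc hc' a k)) => [z _|z|j].
  - by rewrite row_mxEl.
  - by move=> [[cz _] [c'z _]]; split.
  - exact: td_lsubmx.
have -> : i = rshift _ a by exact: val_inj.
apply: td_ext oU _ (@td_comp _ _ _ _ _ _ rsubmx
  (fun y => cfwd d' (cbwd d y) 0 a) oU _ _ (manifold_compat hN hd hd' a k)) => [z _|z|j].
- by rewrite row_mxEr.
- by move=> [[_ dz] [_ d'z]]; split.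
- exact: td_rsubmx.
Qed.
End SmoothMaps.

(** * The right unitor of a composite *)

(** The redundancy, due to Kelly, among the unit axioms of a bicategory.
    Whiskering with an identity 1-cell is faithful, because the right unitor is a
    natural isomorphism, so both sides may be whiskered with the identity of a; they
    may then be composed with the invertible associator of (f, g, 1).  The triangle
    identity for g turns r_g * 1 into 1 * l_1, the pentagon at (f, g, 1, 1) applies,
    and the triangle identity for f g concludes. *)
Lemma bicat_runitor_hcomp (B : bicategory) (a b c : cell0 B) (f : cell1 b c)
    (g : cell1 a b) :
  vcomp (hcomp2 (id2 f) (runitor g)) (associator f g (id1 a)) =
  runitor (hcomp f g).
Proof.
have cancelr (h k : cell1 a c) (u v : cell2 h k) :
    hcomp2 u (id2 (id1 a)) = hcomp2 v (id2 (id1 a)) -> u = v.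
  move=> e; rewrite -[u]vcomp1r -[v]vcomp1r -(runitorVK h) !vcompA.
  by rewrite -!runitor_nat e.
have cancell (h k l : cell1 a c) (i : cell2 k l) (i' : cell2 l k) (u v : cell2 h k) :
    vcomp i' i = id2 k -> vcomp i u = vcomp i v -> u = v.
  by move=> iK e; rewrite -[u]vcomp1l -[v]vcomp1l -iK -!vcompA e.
apply: cancelr; apply: cancell (associatorK f g (id1 a)) _.
rewrite -{1}[id2 (id1 a)]vcomp1l hcomp2_vcomp vcompA associator_nat -!vcompA.
rewrite -(bicat_triangle g (id1 a)) -[X in hcomp2 X (vcomp _ _)](vcomp1l) hcomp2_vcomp.
rewrite -!vcompA bicat_pentagon !vcompA -associator_nat hcomp2_id -!vcompA.
by rewrite bicat_triangle.
Qed.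

(** * Smooth families of arrows acting on representations *)

Section FamiliesOfArrows.
Variables (R : realType) (K : fieldExtType R) (G : lie_groupoid R).
Implicit Types s t : gob G -> gob G.

Definition smooth_family s t (u : forall x, arrow (s x) (t x)) : Prop :=
  smooth (fun x => sval (u x) : garr G).

Lemma smooth_family_inv s t (u : forall x, arrow (s x) (t x)) :
  smooth_family u -> smooth_family (fun x => ainv (G := G) (u x)).
Proof.
have hA := lg_arr_manifold (lgP G).
by move=> su; apply: (smooth_comp (lg_ob_manifold (lgP G)) hA hA su);
   exact: lg_inv_smooth (lgP G).
Qed.

(** The local matrices of a representation are smooth functions on the manifold of
    all arrows, and are here pulled back along x |-> u_x. *)
Lemma smooth_rep_act_family (V : representation K G) s t
    (u : forall x, arrow (s x) (t x)) i j :
  smooth_family u ->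
  smooth_mx [set x | vb_dom V i (s x) /\ vb_dom V j (t x)]
    (fun x => local_matrix i j (rep_act V (u x))).
Proof.
move=> su.
have [cs _] := lg_src_smooth (lgP G); have [ct _] := lg_tgt_smooth (lgP G).
have oD : open [set b : garr G | vb_dom V i (gsrc b) /\ vb_dom V j (gtgt b)].
  apply: openI; (apply: open_comp => [p _|]; last exact: vb_dom_open).
    exact: cs.
  exact: ct.
have := smooth_mx_comp (lg_ob_manifold (lgP G)) (lg_arr_manifold (lgP G)) oD su
  (@rep_act_smooth _ _ _ V i j).
have st x : (gsrc (sval (u x)) = s x) * (gtgt (sval (u x)) = t x).
  by case: (u x) => b [].
set A := _ @^-1` _; set B := [set x | _].
have -> : A = B by apply/seteqP; split=> x; rewrite /A /B /= !st.
congr smooth_mx; apply/funext => x.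
(* [arr (sval (u x))] is [u x] with source and target recomputed. *)
by case: (u x) => b [e1 e2] /=; case: _ / e1; case: _ / e2.
Qed.

Lemma ainv_nat x x' y y' (u : arrow x y) (u' : arrow x' y') (b : arrow x x')
    (c : arrow y y') :
  acomp (G := G) u' b = acomp c u -> acomp (G := G) (ainv u') c = acomp b (ainv u).
Proof.
move=> e; rewrite -[LHS]acomp1r -(acompVr u) -acompA [acomp c _]acompA -e.
by rewrite !acompA acompVl acomp1l.
Qed.
End FamiliesOfArrows.

(** * The constraints of the pseudofunctor *)

Section Comparison.
Variables (R : realType) (K : fieldExtType R) (G : lie_2group R).
Local Notation rep := (representation K G).

Lemma smooth_aass (f g : gob G) : smooth_family (fun x => aass x f g).
Proof.
have h := lg_ob_manifold (lgP G); have hA := lg_arr_manifold (lgP G).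
have h2 := is_manifold_prod h h.
have sp := smooth_partial g h2 h hA (sn_smooth (ass_nat G)).
exact: (smooth_partial f h h hA sp).
Qed.

Lemma smooth_arun : smooth_family (@arun R G).
Proof. exact: sn_smooth (run_nat G). Qed.

Definition F_mul_comp (f g : gob G) (V : rep) :
  rep_hom (F_ob f (F_ob g V)) (F_ob (omul f g) V).
Proof.
exists (fun x => rep_act V (aass x f g)).
- by move=> x a v w; exact: (rep_act_linear (aass x f g) a v w).
- move=> x y b v /=; rewrite -!rep_act_comp; congr (rep_act V _ v).
  by rewrite aass_nat amul_id.
- move=> i j; exact: (@smooth_rep_act_family _ _ _ V _ _ _ i j (smooth_aass f g)).
Defined.

Definition F_mul_inv_comp (f g : gob G) (V : rep) :
  rep_hom (F_ob (omul f g) V) (F_ob f (F_ob g V)).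
Proof.
exists (fun x => rep_act V (ainv (aass x f g))).
- by move=> x a v w; exact: (rep_act_linear (ainv (aass x f g)) a v w).
- move=> x y b v /=; rewrite -!rep_act_comp; congr (rep_act V _ v).
  by apply: ainv_nat; rewrite aass_nat amul_id.
- move=> i j; exact: (@smooth_rep_act_family _ _ _ V _ _ _ i j
    (smooth_family_inv (smooth_aass f g))).
Defined.

Definition F_unit_comp (V : rep) : rep_hom V (F_ob (oone G) V).
Proof.
exists (fun x => rep_act V (ainv (arun x))).
- by move=> x a v w; exact: (rep_act_linear (ainv (arun x)) a v w).
- move=> x y b v /=; rewrite -!rep_act_comp; congr (rep_act V _ v).
  by apply: ainv_nat; exact: arun_nat.
- move=> i j; exact: (@smooth_rep_act_family _ _ _ V _ _ _ i j
    (smooth_family_inv smooth_arun)).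
Defined.

Definition F_unit_inv_comp (V : rep) : rep_hom (F_ob (oone G) V) V.
Proof.
exists (fun x => rep_act V (arun x)).
- by move=> x a v w; exact: (rep_act_linear (arun x) a v w).
- move=> x y b v /=; rewrite -!rep_act_comp; congr (rep_act V _ v).
  exact: arun_nat.
- move=> i j; exact: (@smooth_rep_act_family _ _ _ V _ _ _ i j smooth_arun).
Defined.

Definition F_mul (f g : gob G) :
  nattrans (linfunctor_comp (F_functor K f) (F_functor K g)) (F_functor K (omul f g)).
Proof.
exists (F_mul_comp f g) => V W h; apply: rep_homP => x v /=.
by rewrite rep_map_equivariant.
Defined.

Definition F_mul_inv (f g : gob G) :
  nattrans (F_functor K (omul f g)) (linfunctor_comp (F_functor K f) (F_functor K g)).
Proof.
exists (F_mul_inv_comp f g) => V W h; apply: rep_homP => x v /=.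
by rewrite rep_map_equivariant.
Defined.

Definition F_unit : nattrans (linfunctor_id (Rep K G)) (F_functor K (oone G)).
Proof.
exists F_unit_comp => V W h; apply: rep_homP => x v /=.
by rewrite rep_map_equivariant.
Defined.

Definition F_unit_inv : nattrans (F_functor K (oone G)) (linfunctor_id (Rep K G)).
Proof.
exists F_unit_inv_comp => V W h; apply: rep_homP => x v /=.
by rewrite rep_map_equivariant.
Defined.

Lemma aass_pentagon (x f g h : gob G) :
  acomp (amul (aid x) (aass f g h))
    (acomp (aass x (omul f g) h) (amul (aass x f g) (aid h))) =
  acomp (aass x f (omul g h)) (aass (omul x f) g h).
Proof. by apply: arrowP; exact: l2g_pentagon. Qed.

Lemma aass_alun (x f : gob G) :
  acomp (amul (aid x) (alun f)) (aass x (oone G) f) = amul (arun x) (aid f).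
Proof. by apply: arrowP; exact: l2g_triangle. Qed.

Lemma aass_arun (x f : gob G) :
  acomp (amul (aid x) (arun f)) (aass x f (oone G)) = arun (omul x f).
Proof. exact: (@bicat_runitor_hcomp (delooping G) tt tt tt x f). Qed.
End Comparison.

(** * The pseudofunctor *)

Theorem lemma3 (R : realType) (K : fieldExtType R) (G : lie_2group R) :
  inhabited (pseudofunctor_on
    (@PseudofunctorData (delooping G) (two_vect K)
       (fun _ => Rep K G)
       (fun _ _ g => F_functor K g)
       (fun _ _ _ _ g1 => F_arrow K g1))).
Proof.
set P := (X in pseudofunctor_on X); constructor.
refine (@PseudofunctorOn _ _ P (fun _ _ _ => @F_mul R K G)
  (fun _ _ _ => @F_mul_inv R K G) (fun _ => @F_unit R K G)
  (fun _ => @F_unit_inv R K G) _ _ _ _ _ _ _ _ _ _).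
- move=> ? ? f; apply: nattransP => V; apply: rep_homP => x v /=.
  by rewrite amul_id rep_act_id.
- move=> ? ? f g h u' u; apply: nattransP => V; apply: rep_homP => x v /=.
  by rewrite -rep_act_comp -amul_comp acomp1l.
- move=> ? ? ? f g; apply: nattransP => V; apply: rep_homP => x v /=.
  by rewrite -rep_act_comp acompVl rep_act_id.
- move=> ? ? ? f g; apply: nattransP => V; apply: rep_homP => x v /=.
  by rewrite -rep_act_comp acompVr rep_act_id.
- move=> ?; apply: nattransP => V; apply: rep_homP => x v /=.
  by rewrite -rep_act_comp acompVr rep_act_id.
- move=> ?; apply: nattransP => V; apply: rep_homP => x v /=.
  by rewrite -rep_act_comp acompVl rep_act_id.
- move=> ? ? ? f f' g g' u u'; apply: nattransP => V; apply: rep_homP => x v /=.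
  rewrite -!rep_act_comp; congr (rep_act V _ v).
  by rewrite -acompA -amul_comp acomp1l acomp1r aass_nat.
- move=> ? ? ? ? f g h; apply: nattransP => V; apply: rep_homP => x v /=.
  rewrite -!rep_act_comp; congr (rep_act V _ v).
  by rewrite -acompA; exact: aass_pentagon.
- move=> ? ? f; apply: nattransP => V; apply: rep_homP => x v /=.
  rewrite -!rep_act_comp aass_alun -amul_comp.
  by rewrite acompVr acomp1l amul_id rep_act_id.
- move=> ? ? f; apply: nattransP => V; apply: rep_homP => x v /=.
  rewrite -!rep_act_comp aass_arun.
  by rewrite acompVr rep_act_id.
Qed.
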